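(* Let $f$ be a positive algebraic germ at infinity with irreducible defining polynomial $P\in\mathbb C[z,w]$, $d=\deg_w P$, and let $K\subset\mathbb C$ be a compact convex set with $\mathcal M_f(K)\neq\varnothing$. Then the functional $$\mathfrak D_{P,K}(\mu)=\int_K\left|P\bigl(z,\mathcal C_\mu(z)\bigr)\right|^{1/d}\,dA(z)$$ is finite and weak-$*$ continuous on $\mathcal M_f(K)$ and attains its minimum $\delta_P(f;K)$ there. Moreover, $\delta_P(f;K)=0$ if and only if there exists $\mu\in\mathcal M_f(K)$ such that $$P\bigl(z,\mathcal C_\mu(z)\bigr)=0\qquad\text{for almost every }z\in\mathbb C.$$ If the minimum is zero, every minimizer has this property.
   Context: $dA$ is planar Lebesgue measure. For a finite compactly supported complex Borel measure $\mu$ on $\mathbb C$, its Cauchy transform is $\mathcal C_\mu(z)=\int_{\mathbb C}\frac{d\mu(\zeta)}{z-\zeta}$, which converges absolutely for almost every $z$ and defines an element of $L^1_{\mathrm{loc}}(\mathbb C)$, holomorphic off $\operatorname{supp}\mu$. A positive algebraic germ is an analytic germ at infinity $f(z)=\frac{a_0}{z}+O(z^{-2})$ with $a_0>0$ that is algebraic. Its irreducible defining polynomial is the irreducible $P(z,w)=\sum_{j=0}^d p_j(z)w^j\in\mathbb C[z,w]$, $d=\deg_wP\ge1$, $p_d\not\equiv0$, with $P(z,f(z))=0$ near infinity (unique up to a nonzero constant). $\mathcal M_f(K)$ is the set of positive (Borel) measures $\mu$ with $\operatorname{supp}\mu\subset K$ whose Cauchy transform has germ $f$ at infinity, i.e.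 $\int\zeta^n\,d\mu(\zeta)=m_n(f)$ for all $n\ge0$, where $f(z)=\sum_{n\ge0}m_n(f)z^{-n-1}$ near infinity. The weak-$*$ topology is that of $C(K)^*$. *)

(* Defs.v *)
From HB Require Import structures.
From mathcomp Require Import all_boot all_order all_algebra.
From mathcomp Require Import complex.
From mathcomp Require Import all_classical all_reals all_analysis.

Set Implicit Arguments.
Unset Strict Implicit.
Unset Printing Implicit Defensive.

Import Order.TTheory GRing.Theory Num.Theory.
Import numFieldNormedType.Exports.
Import Normc.

Local Open Scope classical_set_scope.
Local Open Scope ring_scope.
Local Open Scope complex_scope.

(** The plane is [R * R], with its product topology, the product of the Borel
    sigma-algebras (which is the Borel sigma-algebra of the plane) and the
    product of the Lebesgue measures; [toC] identifies it with [R[i]]. *)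
Definition toC (R : realType) (z : R * R) : R[i] := z.1 +i* z.2.

Notation dA R := ((@lebesgue_measure R) \x (@lebesgue_measure R))%E.

(** Off the absolutely convergent case [Rintegral] returns a conventional real
    number, so the value is then meaningless. *)
Definition Cintegral d (T : measurableType d) (R : realType)
    (mu : {measure set T -> \bar R}) (D : set T) (f : T -> R[i]) : R[i] :=
  Rintegral mu D (fun x => complex.Re (f x)) +i*
  Rintegral mu D (fun x => complex.Im (f x)).

Definition plane_measure (R : realType) : Type :=
  {finite_measure set (measurableTypeR R * measurableTypeR R)%type -> \bar R}.

HB.instance Definition _ (R : realType) := gen_eqMixin (plane_measure R).
HB.instance Definition _ (R : realType) := gen_choiceMixin (plane_measure R).

Definition msupport (R : realType) (mu : plane_measure R) : set (R * R) :=
  [set z | forall U : set (R * R), open U -> U z -> (0 < mu U)%E].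

Definition cauchy_transform (R : realType) (mu : plane_measure R)
    (z : R * R) : R[i] :=
  Cintegral mu setT (fun zeta => (toC z - toC zeta)^-1).

(** An analytic germ at infinity vanishing there, given by its Laurent
    expansion [\sum_n m_n / z ^ n.+1]. *)
Record germ (R : realType) := Germ {
  germ_coef :> nat -> R[i] ;
  germ_cvg : exists r : R, forall z : R[i], r < normc z ->
    cvgn (series (fun n => germ_coef n / z ^+ n.+1) : nat -> R[i]^o) }.

Definition germ_value (R : realType) (f : germ R) (z : R[i]) : R[i] :=
  limn (series (fun n => f n / z ^+ n.+1) : nat -> R[i]^o).

(** [P : {poly {poly R[i]}}] is a polynomial in [w] whose coefficients are the
    polynomials [p_j] in [z]. *)
Definition eval2 (R : realType) (P : {poly {poly R[i]}}) (z w : R[i]) : R[i] :=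
  P.[w%:P].[z].

Definition degw (R : realType) (P : {poly {poly R[i]}}) : nat := (size P).-1.

Definition annihilates (R : realType) (P : {poly {poly R[i]}}) (f : germ R) :=
  exists r : R, forall z : R[i], r < normc z -> eval2 P z (germ_value f z) = 0.

Definition positive_algebraic (R : realType) (f : germ R) :=
  0 < f 0%N /\ exists2 P : {poly {poly R[i]}}, P != 0 & annihilates P f.

(** [irreducible_poly] would ask for irreducibility over the fraction field
    [C(z)] only, and so would allow nonconstant factors in [C[z]]. *)
Definition irreducible_elt (A : idomainType) (p : A) :=
  [/\ p != 0, p \isn't a GRing.unit &
      forall a b : A, p = a * b -> a \is a GRing.unit \/ b \is a GRing.unit].

Definition defining_polynomial (R : realType) (f : germ R)
    (P : {poly {poly R[i]}}) :=
  [/\ irreducible_elt P, (1 <= degw P)%N & annihilates P f].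

Definition germ_measures (R : realType) (f : germ R) (K : set (R * R)) :
    set (plane_measure R) :=
  [set mu | msupport mu `<=` K /\
            forall n, Cintegral mu setT (fun zeta => toC zeta ^+ n) = f n].

Definition continuous_on (R : realType) (K : set (R * R)) : Type :=
  {phi : R * R -> R[i]^o | {within K, continuous phi}}.

HB.instance Definition _ (R : realType) (K : set (R * R)) :=
  gen_eqMixin (continuous_on K).

(** The weak-star topology of [C(K)^*]: the coarsest one making
    [mu |-> \int_K phi dmu] continuous for each [phi] in [C(K)]. *)
Definition weak_star (R : realType) (K : set (R * R)) : topologicalType :=
  initial_topology ((fun mu phi => Cintegral mu K (sval phi))
    : plane_measure R -> {ptws continuous_on K -> R[i]^o}).

Definition defect (R : realType) (P : {poly {poly R[i]}}) (K : set (R * R))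
    (mu : plane_measure R) : \bar R :=
  (\int[dA R]_(z in K)
     (normc (eval2 P (toC z) (cauchy_transform mu z)) `^ (degw P)%:R^-1)%:E)%E.

Definition min_defect (R : realType) (P : {poly {poly R[i]}}) (f : germ R)
    (K : set (R * R)) : \bar R :=
  ereal_inf (defect P K @` germ_measures f K).

Definition solves_ae (R : realType) (P : {poly {poly R[i]}})
    (mu : plane_measure R) :=
  {ae dA R, forall z, eval2 P (toC z) (cauchy_transform mu z) = 0}.

(* Main.v *)
(** Continuity of the functional: replacing the Cauchy kernel [1/w] by the
    continuous kernel [conj w / max (|w|^2, e^2)] changes [C_mu] by an error whose
    integral over the plane is at most a constant times [e mu(C)], and
    [|P(z,w)|^(1/d)] is Lipschitz in [w] up to a small multiple of [1 + |w|]; for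
    the truncated kernels, weak convergence gives uniform convergence of the
    potentials on [K].

    Existence of a minimizer: along an ultrafilter, the masses of the cells of the
    dyadic grids converge; the corresponding quantile functions map the interval
    from [0] to [mu(C)] to nested cells, hence to points of [K], and the image of
    the Lebesgue measure under the limit map is a weak limit of the measures.
    Neither Riesz's representation theorem nor the separability of [C(K)] is used.

    Off [K]: a point [z] outside of the convex set [K] is separated from [K] by a
    circle around some [c], and [C_mu] is a power series in [1/(z - c)] outside of
    the circle, so that [P(z, C_mu(z)) = 0] propagates there from infinity. Hence
    the equation holds almost everywhere as soon as it does so on [K]. *)
Require Import Defs.
From HB Require Import structures.
From mathcomp Require Import all_boot all_order all_algebra.
From mathcomp Require Import complex.
From mathcomp Require Import all_classical all_reals all_analysis.
From mathcomp Require Import measurable_realfun.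
From mathcomp Require Import ring lra.

Import Order.TTheory GRing.Theory Num.Theory.
Import numFieldNormedType.Exports.

Set Implicit Arguments.
Unset Strict Implicit.
Unset Printing Implicit Defensive.

Local Open Scope classical_set_scope.
Local Open Scope ring_scope.

(** * Measurability in the plane *)

(** The obstacle is that the Cauchy kernel is neither bounded nor continuous: weak convergence says
    nothing about [C_mu(z)] at a given point, and only integrals over the plane are stable. The
    exponent [1/d] is exactly what is needed there: it turns growth of degree [d] in [w] into linear
    growth, which the local integrability of [C_mu] can pay for. The root is not Lipschitz near the
    zeros of [P], hence the small multiple of [1 + |w|] in its modulus. The constants are uniform
    because the zeroth moment gives all competitors the same mass.

    The real and imaginary parts of the kernel are treated as two real kernels. The norm of [R * R]
    is the sup norm, so that balls are squares, of explicit area. Convergence is stated along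
    arbitrary filters: one lemma then serves both for the continuity of the functional and for the
    minimizer.

    The propagation from infinity is quantitative: it compares the power series with its
    truncations, for which the equation becomes a statement on coefficients of polynomials. *)

Notation plane R := (measurableTypeR R * measurableTypeR R)%type.

Section PlaneMeasurability.
Variable R : realType.
Implicit Types (U A K : set (R * R)).

Definition rational_box (q : rat * rat * nat) : set (plane R) :=
  (ball (ratr q.1.1 : R) (q.2.+1%:R^-1)) `*` (ball (ratr q.1.2 : R) (q.2.+1%:R^-1)).

Lemma measurable_rational_box q : measurable (rational_box q).
Proof. by apply: measurableX; apply: open_measurable; apply: ball_open. Qed.

Lemma rational_box_basis U z : open U -> U z ->
  exists2 q, rational_box q z & rational_box q `<=` U.
Proof.
move=> oU; case: z => x y Uxy.
have /nbhs_ballP [e /= e0 eU] : nbhs (x, y) U by apply: open_nbhs_nbhs.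
have [n /= ne] : exists n : nat, n.+1%:R^-1 < e / 2.
  have e20 : 0 < e / 2 by rewrite divr_gt0.
  have [n _ /(_ n (leqnn n))] := near_infty_natSinv_lt (PosNum e20).
  by exists n.
have n0 : 0 < (n.+1%:R^-1 : R) by rewrite invr_gt0.
have close (a b c r : R) : `|a - b| < r -> `|a - c| < r -> r < e / 2 -> `|b - c| < e.
  by have := ler_distD a b c; rewrite (distrC b a); lra.
have dense (t : R) : exists p : rat, `|ratr p - t| < n.+1%:R^-1.
  have /rat_in_itvoo[p] : t - n.+1%:R^-1 < t + n.+1%:R^-1.
    by rewrite ltrBlDr -addrA ltrDl addr_gt0.
  by rewrite in_itv /= => pt; exists p; rewrite ltr_distl.
have [[p px] [q qy]] := (dense x, dense y).
exists (p, q, n); first by split; rewrite /ball /=.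
move=> [s t] /= [ps qt]; apply: eU; split => /=.
  exact: close px ps ne.
exact: close qy qt ne.
Qed.

(** Enumerates a family of boxes through the countability of their indices, with empty sets as
    fillers, so that results on sequences of sets apply. *)
Definition box_sequence (A : set (rat * rat * nat)) (n : nat) : set (plane R) :=
  if (unpickle n : option (rat * rat * nat)) is Some q then
    if `[< A q >] then rational_box q else set0
  else set0.

Lemma box_sequenceE (A : set (rat * rat * nat)) :
  \bigcup_n box_sequence A n = \bigcup_(q in A) rational_box q.
Proof.
apply/seteqP; split => [z [n _]|z [q Aq qz]].
  rewrite /box_sequence; case: (unpickle n) => [q|] //.
  by case: ifPn => // /asboolP Aq qz; exists q.
have FE k : box_sequence A (pickle k) = if `[< A k >] then rational_box k else set0.
  by rewrite /box_sequence pickleK.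
exists (pickle q); first exact: I.
by rewrite FE asboolT.
Qed.

Lemma open_measurable_plane U : open U -> measurable (U : set (plane R)).
Proof.
move=> oU; rewrite (_ : U = \bigcup_n box_sequence [set q | rational_box q `<=` U] n).
  apply: bigcupT_measurable => n; rewrite /box_sequence.
  by case: (unpickle n) => [q|] //; case: ifP => // _; exact: measurable_rational_box.
rewrite box_sequenceE; apply/seteqP; split => [z Uz|z [q qU]]; last exact: qU.
by have [q qz qU] := rational_box_basis oU Uz; exists q.
Qed.

(** A Lindelöf argument: each point lies in a null rational box, and there are only countably many
    of these. It is used to show that the complement of a set containing the support is null. *)
Lemma open_null_plane (mu : {measure set (plane R) -> \bar R}) U : open U ->
  (forall z, U z -> exists V : set (R * R), [/\ open V, V z & mu V = 0%E]) -> mu U = 0%E.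
Proof.
move=> oU nullU; pose A := [set q | mu (rational_box q) = 0%E].
have /negligibleP : mu.-negligible (\bigcup_n box_sequence A n).
  apply: negligible_bigcup => n; rewrite /box_sequence.
  case: (unpickle n) => [q|]; last exact: negligible_set0.
  case: ifPn => [/asboolP Aq|_]; last exact: negligible_set0.
  by apply/negligibleP => //; exact: measurable_rational_box.
rewrite box_sequenceE => mu0; apply/eqP; rewrite eq_le measure_ge0 andbT.
have mA : measurable (\bigcup_(q in A) rational_box q).
  rewrite -box_sequenceE; apply: bigcupT_measurable => n; rewrite /box_sequence.
  by case: (unpickle n) => [q|] //; case: ifP => // _; exact: measurable_rational_box.
rewrite -(mu0 mA); apply: le_measure; rewrite ?inE//; first exact: open_measurable_plane.
move=> z Uz; have [V [oV Vz V0]] := nullU z Uz.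
have [q qz qV] := rational_box_basis oV Vz; exists q => //.
apply: (@subset_measure0 _ _ _ mu _ V) => //.
- exact: measurable_rational_box.
- exact: open_measurable_plane.
Qed.

Lemma closed_measurable_plane A : closed A -> measurable (A : set (plane R)).
Proof.
by move=> /closed_openC/open_measurable_plane/measurableC; rewrite setCK.
Qed.

Lemma compact_measurable_plane K : compact K -> measurable (K : set (plane R)).
Proof.
by move=> cK; apply: closed_measurable_plane; apply: compact_closed.
Qed.

Lemma continuous_measurable_plane (f : R * R -> R) :
  continuous f -> measurable_fun setT (f : plane R -> R).
Proof.
move=> /continuousP cf; apply: (measurability _ (RGenOpens.measurableE R)).
move=> _ [_ [a [b ->] <-]]; rewrite setTI; apply: open_measurable_plane.
exact/cf/interval_open.
Qed.

End PlaneMeasurability.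

Lemma area_sigma_finite (R : realType) : sigma_finite setT (dA R).
Proof.
pose B n : set (measurableTypeR R) := `[- n%:R, n%:R]%classic.
have mB n : measurable (B n) by exact: measurable_itv.
exists (fun n => B n `*` B n).
  apply/esym/seteqP; split => // -[x y] _ /=.
  have [n nx] : exists n : nat, `|x| + `|y| <= n%:R.
    by exists (Num.truncn (`|x| + `|y|)).+1; rewrite ltW// truncnS_gt.
  exists n => //; rewrite /B /= !in_itv /= -!ler_norml.
  by split; apply: le_trans nx; rewrite ?lerDl ?lerDr.
move=> n; split; first exact: measurableX.
have Boo : (lebesgue_measure (B n) < +oo)%E.
  by rewrite /B lebesgue_measure_itv /=; case: ifP; rewrite ltry.
by rewrite product_measure1E// lte_mul_pinfty// ge0_fin_numE.
Qed.

(* The library does not register the product measure as sigma-finite, which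
   Tonelli's theorem requires. *)
Definition area (R : realType) : set (plane R) -> \bar R := dA R.

HB.instance Definition _ (R : realType) := Measure.copy (@area R)
  (dA R : {measure set (plane R) -> \bar R}).

HB.instance Definition _ (R : realType) :=
  Measure_isSigmaFinite.Build _ _ _ (@area R) (@area_sigma_finite R).

(** * Cauchy kernels and their truncations *)

Section Kernels.
Variable R : realType.
Implicit Types (e : R) (w z : R * R).

Definition sqnorm w : R := w.1 ^+ 2 + w.2 ^+ 2.

Lemma sqnorm_ge0 w : 0 <= sqnorm w.
Proof. by rewrite addr_ge0 ?sqr_ge0. Qed.

Lemma normP_max (w : R * R) : `|w| = Num.max `|w.1| `|w.2|.
Proof. by []. Qed.

Lemma norm_le_sqnorm w : `|w| ^+ 2 <= sqnorm w.
Proof.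
rewrite normP_max /Num.max /sqnorm; case: ifPn => _; rewrite real_normK ?num_real//.
- by rewrite lerDr sqr_ge0.
- by rewrite lerDl sqr_ge0.
Qed.

Lemma continuous_fst_plane : continuous (fun w : R * R => w.1).
Proof. by move=> w; exact: cvg_fst. Qed.

Lemma continuous_snd_plane : continuous (fun w : R * R => w.2).
Proof. by move=> w; exact: cvg_snd. Qed.

Lemma continuous_sqnorm : continuous sqnorm.
Proof.
by move=> w; apply: cvgD; apply: cvgM;
  (exact: continuous_fst_plane || exact: continuous_snd_plane).
Qed.

(** The inverse is the power of exponent [-1], also at 0, where both are 0 by convention. *)
Lemma measurable_inv_nneg d (T : measurableType d) (f : T -> R) :
  measurable_fun setT f -> (forall x, 0 <= f x) ->
  measurable_fun setT (fun x => (f x)^-1).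
Proof.
move=> mf f0.
rewrite (_ : (fun x => (f x)^-1) = (@powR R ^~ (-1)) \o f).
  by apply: measurableT_comp => //; exact: measurable_powR.
by apply/funext => x /=; rewrite powR_inv1.
Qed.

(** Dominates the difference between a Cauchy kernel and its truncation at scale [e]; its value at 0
    is 0, as [0^-1 = 0]. *)
Definition spike e w : R := if `|w| < e then `|w|^-1 else 0.

Lemma spike_ge0 e w : 0 <= spike e w.
Proof. by rewrite /spike; case: ifP => // _; rewrite invr_ge0. Qed.

Lemma measurable_norm_plane : measurable_fun setT ((fun w => `|w|) : plane R -> R).
Proof. by apply: continuous_measurable_plane; exact: norm_continuous. Qed.

Lemma measurable_spike e : measurable_fun setT (spike e : plane R -> R).
Proof.
apply: measurable_fun_ifT => //.
- by apply: measurable_fun_ltr => //; exact: measurable_norm_plane.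
- by apply: measurable_inv_nneg => //; exact: measurable_norm_plane.
Qed.

Lemma measurable_translate (f : plane R -> R) :
  measurable_fun setT f ->
  measurable_fun setT (fun p : plane R * plane R => f (p.1.1 - p.2.1, p.1.2 - p.2.2)).
Proof.
move=> mf; apply: (measurableT_comp mf); apply: measurable_fun_pair;
  apply: measurable_funB; do ?[exact: measurable_fst|exact: measurable_snd
  | apply: measurableT_comp; do ?[exact: measurable_fst|exact: measurable_snd]].
Qed.

Lemma sum_half (n : nat) : \sum_(0 <= k < n) (2^-1 : R) ^+ k <= 2.
Proof.
suff -> : \sum_(0 <= k < n) (2^-1 : R) ^+ k = 2 - 2 * 2^-1 ^+ n.
  by rewrite gerBl mulr_ge0// exprn_ge0.
elim: n => [|n IH]; first by rewrite big_nil expr0; lra.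
rewrite big_nat_recr//= IH exprS; lra.
Qed.

(* [1/|w|] is dominated by the sum over the dyadic squares containing [w] of
   the inverses of their sizes, which have a summable integral. *)
Lemma spike_dyadic e w : 0 < e ->
  ((spike e w)%:E <= \sum_(0 <= k <oo)
    (2 ^+ k.+1 / e * \1_(ball (0 : R * R) (e * 2^-1 ^+ k)) w)%:E)%E.
Proof.
move=> e0.
have t0 k : 0 <= (2 ^+ k.+1 / e * \1_(ball (0 : R * R) (e * 2^-1 ^+ k)) w : R).
  by rewrite mulr_ge0// divr_ge0 ?exprn_ge0// ltW.
rewrite /spike; case: ifPn => [we|_]; last first.
  by apply: nneseries_ge0 => k _ _; rewrite lee_fin.
have [w0|] := eqVneq `|w| 0.
  by rewrite w0 invr0; apply: nneseries_ge0 => k _ _; rewrite lee_fin.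
rewrite -normr_gt0 normr_id => w0.
pose Q (k : nat) := `|w| < e * 2^-1 ^+ k.
(* The smallest dyadic square containing [w]: from [|w| >= e 2^-(k+1)], the single term of index [k]
   already dominates [1/|w|]. *)
have [k Qk nQk] : exists2 k, Q k & ~~ Q k.+1.
  have exn : exists n, ~~ Q n.
    have : (fun n => e * 2^-1 ^+ n) @ \oo --> e * 0.
      apply: cvgMl_tmp; apply: cvg_expr.
      by rewrite ger0_norm// invf_lt1// ltr1n.
    rewrite mulr0 => /cvgrPdist_lt/(_ _ w0)[n _ /(_ n (leqnn n))] /=.
    rewrite sub0r normrN ger0_norm ?mulr_ge0 ?exprn_ge0// ?(ltW e0)// => h.
    by exists n; rewrite /Q -leNgt ltW.
  case: (ex_minnP exn) => -[|n] nQ minQ.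
    by move: nQ; rewrite /Q expr0 mulr1 we.
  by exists n => //; apply: contraT => /minQ; rewrite ltnn.
apply: le_trans (nneseries_lim_ge k.+1 _); last by move=> n _ _; rewrite lee_fin.
rewrite big_nat_recr//=; apply: le_trans (leeDr _ _); last first.
  by apply: sume_ge0 => n _; rewrite lee_fin.
rewrite lee_fin indicE mem_set ?mulr1; last first.
  by rewrite -ball_normE /= sub0r normrN.
move: nQk; rewrite /Q -leNgt => h.
rewrite -[leLHS]mulr1 mulrC ler_pdivrMr// mulrAC ler_pdivlMr// mul1r.
move: h; rewrite exprVn ler_pdivrMr ?exprn_gt0// mulrC => h; exact: h.
Qed.

Lemma area_ball (z : R * R) e : 0 <= e -> dA R (ball z e) = ((2 * e) ^+ 2)%:E.
Proof.
move=> e0; rewrite (_ : ball z e = (ball z.1 e : set (measurableTypeR R))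
    `*` (ball z.2 e : set (measurableTypeR R))); last by [].
rewrite product_measure1E; do ?exact: measurable_ball.
rewrite -[X in (X * _)%E]/(lebesgue_measure _) -[X in (_ * X)%E]/(lebesgue_measure _).
by rewrite !lebesgue_measure_ball// -EFinM; congr EFin; rewrite !mulr2n; ring.
Qed.

(** The [k]-th square has area [(2 e 2^-k)^2] and weight [2^(k+1) / e], hence contributes
    [8 e 2^-k]; the geometric sum gives [16 e], wherever the pole [z] is. *)
Lemma integral_spike e z : 0 < e ->
  (\int[dA R]_y (spike e (y - z))%:E <= (16 * e)%:E)%E.
Proof.
move=> e0.
pose F k (y : plane R) := (2 ^+ k.+1 / e * \1_(ball z (e * 2^-1 ^+ k) : set (plane R)) y)%:E.
have F0 k y : (0 <= F k y)%E.
  by rewrite lee_fin mulr_ge0// divr_ge0 ?exprn_ge0// ltW.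
have mball k : measurable (ball z (e * 2^-1 ^+ k) : set (plane R)).
  by apply: open_measurable_plane; exact: ball_open.
have mF k : measurable_fun setT (F k).
  by apply/measurable_EFinP; apply: measurable_funM => //; exact: measurable_indic.
apply: (@le_trans _ _ (\int[dA R]_y \sum_(0 <= k <oo) F k y)%E).
  apply: ge0_le_integral => //.
  - by move=> y _; rewrite lee_fin spike_ge0.
  - apply/measurable_EFinP; apply: (measurable_fun_pair1 (z : plane R)
      (measurable_translate (measurable_spike e))).
  - by apply: ge0_emeasurable_sum.
  - move=> y _; apply: le_trans (spike_dyadic _ e0) _.
    rewrite le_eqVlt; apply/orP; left; apply/eqP; apply: eq_eseriesr => k _.
    congr (EFin (_ * _)); rewrite !indicE; congr (nat_of_bool _)%:R.
    apply/idP/idP; rewrite !inE -!ball_normE /= sub0r normrN distrC; exact.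
rewrite integral_nneseries//.
apply: lime_le; first by apply: is_cvg_nneseries => n _ _; exact: integral_ge0.
apply: nearW => n.
apply: (@le_trans _ _ (\sum_(0 <= k < n) (8 * e * 2^-1 ^+ k)%:E)%E).
  apply: lee_sum => k _.
  under eq_integral do rewrite /F EFinM.
  rewrite ge0_integralZl//; last first.
  - by rewrite lee_fin divr_ge0 ?exprn_ge0// ltW.
  - by apply/measurable_EFinP; exact: measurable_indic.
  have r0 : 0 <= e * 2^-1 ^+ k by rewrite mulr_ge0 ?exprn_ge0// ltW.
  rewrite integral_indic// setIT -[X in (_ * X)%E]/(dA R (ball z (e * 2^-1 ^+ k))).
  rewrite area_ball//.
  rewrite -EFinM lee_fin.
  rewrite (_ : 2 ^+ k.+1 / e * _ = 8 * e * (2 ^+ k * 2^-1 ^+ k) * 2^-1 ^+ k); last first.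
    by rewrite exprS; field; rewrite gt_eqF.
  by rewrite -exprMn mulfV// expr1n mulr1.
rewrite sumEFin lee_fin -mulr_sumr.
apply: le_trans (ler_wpM2l _ (sum_half n)) _; first by rewrite mulr_ge0// ltW.
by lra.
Qed.

End Kernels.

(** Tonelli applies to the positive and negative parts separately, and [fine] assigns a value even
    where their difference is not finite; so potentials are measurable on the whole plane. *)
Lemma measurable_fun_Rintegral_param d1 d2 (T1 : measurableType d1)
    (T2 : measurableType d2) (R : realType)
    (m2 : {sigma_finite_measure set T2 -> \bar R}) (f : T1 * T2 -> R) :
  measurable_fun setT f ->
  measurable_fun setT (fun x => Rintegral m2 setT (fun y => f (x, y))).
Proof.
move=> /measurable_EFinP mf.
rewrite (_ : (fun x => _) = fine \o
  (fubini_F m2 (funepos (EFin \o f)) \- fubini_F m2 (funeneg (EFin \o f)))%E).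
  apply: measurableT_comp; first exact: fine_measurable.
  apply: emeasurable_funB; apply: measurable_fun_fubini_tonelli_F => //.
  - exact: measurable_funepos.
  - exact: measurable_funeneg.
apply/funext => x; rewrite /Rintegral integralE /comp /fubini_F; congr fine.
by congr (_ - _)%E; apply: eq_integral => y _; rewrite ?funeposE ?funenegE.
Qed.

Lemma integrable_bounded d (T : measurableType d) (R : realType)
    (mu : {finite_measure set T -> \bar R}) (f : T -> R) (M : R) :
  measurable_fun setT f -> (forall x, `|f x| <= M) ->
  mu.-integrable setT (EFin \o f).
Proof.
move=> mf fM; apply: measurable_bounded_integrable => //.
  by rewrite -ge0_fin_numE//; exact: fin_num_measure.
exists M; split; first exact: num_real.
by move=> r Mr x _ /=; apply: le_trans (fM x) (ltW Mr).
Qed.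

(** * Potentials of measures and the cost of truncating a kernel *)

Section Potentials.
Variable R : realType.
Implicit Types (e : R) (z : R * R) (k h : R * R -> R) (M : R) (mu nu : plane_measure R).

Definition pot mu k z : R := Rintegral mu setT (fun zeta => k (z - zeta)).

Definition spike_pot e mu z : \bar R := (\int[mu]_zeta (spike e (z - zeta))%:E)%E.

Lemma measurable_kernel k z : measurable_fun setT (k : plane R -> R) ->
  measurable_fun setT ((fun zeta => k (z - zeta)) : plane R -> R).
Proof. by move=> mk; exact: (measurable_fun_pair2 (z : plane R) (measurable_translate mk)). Qed.

Lemma measurable_pot mu k : measurable_fun setT (k : plane R -> R) ->
  measurable_fun setT (pot mu k : plane R -> R).
Proof.
move=> mk; exact: (measurable_fun_Rintegral_param mu (measurable_translate mk)).
Qed.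

Lemma measurable_spike_pot e mu :
  measurable_fun setT (spike_pot e mu : plane R -> \bar R).
Proof.
have /measurable_EFinP m2 := measurable_translate (measurable_spike e).
have s0 (p : plane R * plane R) : (0 <= (spike e (p.1.1 - p.2.1, p.1.2 - p.2.2)%R)%:E)%E.
  by rewrite lee_fin spike_ge0.
have := @measurable_fun_fubini_tonelli_F _ _ _ _ _ mu _ m2.
by move=> /(_ s0).
Qed.

Lemma spike_pot_ge0 e mu z : (0 <= spike_pot e mu z)%E.
Proof. by apply: integral_ge0 => zeta _; rewrite lee_fin spike_ge0. Qed.

(** By Tonelli, the area integral is taken first, and its bound does not depend on the pole: the
    cost of truncation depends on [mu] through its mass only. *)
Lemma integral_spike_pot e mu : 0 < e ->
  (\int[dA R]_z spike_pot e mu z <= (16 * e)%:E * mu setT)%E.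
Proof.
move=> e0.
have /measurable_EFinP m2 := measurable_translate (measurable_spike e).
have s0 (p : plane R * plane R) : (0 <= (spike e (p.1.1 - p.2.1, p.1.2 - p.2.2)%R)%:E)%E.
  by rewrite lee_fin spike_ge0.
have /= := @fubini_tonelli _ _ _ _ _ (@area R) mu _ m2; move=> /(_ s0) ft.
rewrite [leLHS]ft -integral_cst//; apply: ge0_le_integral => //.
- by move=> zeta _; apply: integral_ge0 => z _; rewrite lee_fin spike_ge0.
- have := @measurable_fun_fubini_tonelli_G _ _ _ _ _ (@area R) _ m2.
  by move=> /(_ s0).
- by move=> zeta _; exact: (integral_spike zeta e0).
Qed.

(** Where the right-hand side is infinite there is nothing to prove. Elsewhere [k (z - zeta)] is the
    sum of a bounded function and of one dominated by an integrable spike, so it is integrable and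
    the integral is linear. *)
Lemma pot_truncate mu k h e M z :
  measurable_fun setT (k : plane R -> R) -> measurable_fun setT (h : plane R -> R) ->
  (forall w, `|h w| <= M) -> (forall w, `|k w - h w| <= spike e w) ->
  (`|pot mu k z - pot mu h z|%:E <= spike_pot e mu z)%E.
Proof.
move=> mk mh hM khe.
have [->|Toy] := eqVneq (spike_pot e mu z) +oo%E; first by rewrite leey.
have ih : mu.-integrable setT (EFin \o (fun zeta => h (z - zeta))).
  by apply: (@integrable_bounded _ _ _ _ _ M) => //; exact: measurable_kernel.
have ispike : mu.-integrable setT (EFin \o (fun zeta => spike e (z - zeta))).
  apply/integrableP; split.
    by apply/measurable_EFinP; apply: measurable_kernel; exact: measurable_spike.
  under eq_integral do rewrite /= ger0_norm ?spike_ge0//.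
  by rewrite ltey.
have id : mu.-integrable setT (EFin \o (fun zeta => k (z - zeta) - h (z - zeta))).
  apply: le_integrable ispike => //.
    by apply/measurable_EFinP; apply: measurable_funB; exact: measurable_kernel.
  by move=> zeta _ /=; rewrite lee_fin [leRHS]ger0_norm ?spike_ge0.
have ik : mu.-integrable setT (EFin \o (fun zeta => k (z - zeta))).
  pose kh zeta := k (z - zeta) - h (z - zeta); pose hz zeta := h (z - zeta).
  rewrite (_ : _ \o _ = ((EFin \o kh) \+ (EFin \o hz))%E); first exact: integrableD.
  by apply/funext => zeta /=; rewrite -EFinD subrK.
rewrite /pot -RintegralB//; apply: le_trans (_ : _ <=
  (Rintegral mu setT (fun zeta => `|k (z - zeta) - h (z - zeta)|))%:E)%E _.
  by rewrite lee_fin; apply: le_normr_Rintegral.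
rewrite /Rintegral fineK; last first.
  by apply: integrable_fin_num => //; exact: integrable_norm.
apply: ge0_le_integral => //.
- by apply/measurable_EFinP; apply: measurableT_comp => //; apply/measurable_EFinP;
    exact: (measurable_int _ id).
- exact: (measurable_int _ ispike).
- by move=> zeta _; rewrite lee_fin.
Qed.

Lemma pot_bounded mu h M z : measurable_fun setT (h : plane R -> R) ->
  (forall w, `|h w| <= M) -> (`|pot mu h z|%:E <= M%:E * mu setT)%E.
Proof.
move=> mh hM.
have ih : mu.-integrable setT (EFin \o (fun zeta => h (z - zeta))).
  by apply: (@integrable_bounded _ _ _ _ _ M) => //; exact: measurable_kernel.
rewrite EFin_normr_Rintegral//.
apply: le_trans (le_abse_integral mu measurableT (measurable_int _ ih)) _.
apply: integral_le_bound => //.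
- by apply: (measurable_int _ ih).
- by rewrite lee_fin (le_trans _ (hM 0)).
- by apply: aeW => zeta _ /=; rewrite lee_fin.
Qed.

End Potentials.

(** * Measures carried by a compact set *)

Section Concentrated.
Variable R : realType.
Implicit Types (mu nu : plane_measure R) (K : set (R * R)) (f g : R * R -> R).

Lemma integrable_on mu K f (M : R) : measurable (K : set (plane R)) ->
  mu (~` K) = 0%E -> measurable_fun setT (f : plane R -> R) ->
  (forall z, K z -> `|f z| <= M) -> mu.-integrable setT (EFin \o f).
Proof.
move=> mK muK mf fM.
have /negligible_integrable := measurableC mK.
move=> /(_ _ mu setT (EFin \o f) measurableT) ->//; last exact/measurable_EFinP.
rewrite setTD setCK; apply: measurable_bounded_integrable => //.
- by rewrite -ge0_fin_numE//; exact: fin_num_measure.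
- exact: measurable_funTS.
exists M; split; first exact: num_real.
by move=> r Mr x Kx; apply: le_trans (fM x Kx) (ltW Mr).
Qed.

Lemma integrable_continuous mu K f : compact K -> mu (~` K) = 0%E ->
  continuous f -> mu.-integrable setT (EFin \o f).
Proof.
move=> cK muK cf.
have /compact_bounded[M [_ hM]] := continuous_compact (continuous_subspaceT cf) cK.
apply: (@integrable_on _ K _ (M + 1)) => //.
- exact: compact_measurable_plane.
- exact: continuous_measurable_plane.
- by move=> z Kz; apply: (hM (M + 1)); rewrite ?ltrDl//; exists z.
Qed.

Lemma Rintegral_on mu K f : measurable (K : set (plane R)) ->
  mu (~` K) = 0%E -> mu.-integrable setT (EFin \o f) ->
  Rintegral mu setT f = Rintegral mu K f.
Proof.
move=> mK muK intf; congr fine.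
by rewrite (negligible_integral (measurableC mK))// setTD setCK.
Qed.

Lemma normr_Rintegral_on mu K f (M : R) : measurable (K : set (plane R)) ->
  mu (~` K) = 0%E -> mu.-integrable setT (EFin \o f) ->
  (forall z, K z -> `|f z| <= M) ->
  `|Rintegral mu setT f| <= M * fine (mu setT).
Proof.
move=> mK muK intf fM; rewrite (Rintegral_on mK)//.
have iK : mu.-integrable K (EFin \o f) by exact: integrableS intf.
have -> : mu setT = mu K.
  have : mu setT = (mu (~` K) + mu K)%E.
    by rewrite -measureU ?setvU//; [exact: measurableC|exact: setICl].
  by rewrite muK add0e.
rewrite -Rintegral_cst//; apply: le_trans (le_normr_Rintegral _ _) _ => //.
apply: le_Rintegral => //.
- exact: integrable_norm.
- exact: finite_measure_integrable_cst.
Qed.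

(* Equicontinuity of the translates [zeta |-> g (z - zeta)], [z] in the compact
   set [K], upgrades weak convergence to uniform convergence of the potentials. *)
Lemma pot_cvg_uniform (F : set_system (plane_measure R)) (K : set (R * R)) mu
    (a : R) g (M s : R) : Filter F -> compact K -> continuous g ->
  (forall w, `|g w| <= M) ->
  mu (~` K) = 0%E -> mu setT = a%:E ->
  F [set nu : plane_measure R | nu (~` K) = 0%E /\ nu setT = a%:E] ->
  (forall h, continuous h ->
    (fun nu : plane_measure R => Rintegral nu setT h) @ F --> Rintegral mu setT h) ->
  0 < s ->
  \forall nu \near F, K `<=` [set z | `|pot mu g z - pot nu g z| <= s].
Proof.
move=> FF cK cg gM muK muT FK Fcvg s0.
have mK := compact_measurable_plane cK.
have a0 : 0 <= a by rewrite -lee_fin -muT.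
(* A third of [s] for each of the three differences in the final comparison; [a + 1] rather than
   [a], as the mass may be 0. *)
pose s1 := s / (3 * (a + 1)).
have s10 : 0 < s1 by rewrite divr_gt0// mulr_gt0// ltr_wpDl.
have s1a : s1 * a <= s / 3.
  have a1 : 0 < a + 1 by rewrite ltr_wpDl.
  rewrite (_ : s1 * a = s / 3 * (a / (a + 1))); last by rewrite /s1; field; rewrite gt_eqF.
  by rewrite ler_piMr ?(divr_ge0 (ltW s0))// ler_pdivrMr// mul1r lerDl.
have ginv (z : R * R) : continuous (fun zeta : R * R => g (z - zeta)).
  by move=> zeta; apply: continuous_comp; [apply: cvgB; [exact: cvg_cst|exact: cvg_id]|exact: cg].
move/compact_near_coveringP : (cK) => cover.
have potK nu (x z : R * R) : nu (~` K) = 0%E -> nu setT = a%:E ->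
    (forall zeta : R * R, K zeta -> `|g (x - zeta) - g (z - zeta)| <= s1) ->
    `|pot nu g x - pot nu g z| <= s / 3.
  move=> nuK nuT xz; apply: le_trans _ s1a; rewrite /pot -RintegralB//; last 2 first.
  - exact: (integrable_continuous cK).
  - exact: (integrable_continuous cK).
  rewrite -[a]/(fine a%:E) -nuT; apply: (normr_Rintegral_on mK) => //.
  apply: (@integrable_continuous nu K) => // zeta.
  by apply: cvgB; exact: ginv.
(* The near-covering form of compactness is used twice: here over [z], with the measure as
   parameter, and below over [zeta], with [z] as parameter. *)
apply: (cover _ F (fun nu z => `|pot mu g z - pot nu g z| <= s)) => x Kx.
have near_x : \forall z \near x, K `<=` [set zeta : R * R | `|g (x - zeta) - g (z - zeta)| <= s1].
  apply: (cover _ (nbhs x) (fun z zeta => `|g (x - zeta) - g (z - zeta)| <= s1)) => zeta Kzeta.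
  have : (fun p : (R * R) * (R * R) => `|g (x - p.1) - g (p.2 - p.1)|) @ (zeta, x)
      --> `|g (x - zeta) - g (x - zeta)|.
    apply: cvg_norm; apply: cvgB; (apply: continuous_cvg; first exact: cg).
    - by apply: cvgB; [exact: cvg_cst|exact: cvg_fst].
    - by apply: cvgB; [exact: cvg_snd|exact: cvg_fst].
  rewrite subrr normr0 => /cvgrPdist_le/(_ _ s10).
  apply: filterS => -[zeta' z] /=; rewrite sub0r normrN normr_id; exact.
have near_nu : \forall nu \near F, `|pot mu g x - pot nu g x| <= s / 3.
  by have /cvgrPdist_le := Fcvg _ (ginv x); apply; rewrite divr_gt0.
exists ([set z : R * R | K `<=` [set zeta : R * R | `|g (x - zeta) - g (z - zeta)| <= s1]],
  [set nu : plane_measure R | (nu (~` K) = 0%E /\ nu setT = a%:E) /\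
    `|pot mu g x - pot nu g x| <= s / 3]).
  by split => //=; apply: filterI.
move=> [z nu] /= [zK [[nuK nuT] nux]].
have := potK mu x z muK muT zK; have := potK nu x z nuK nuT zK.
have := ler_normD (pot mu g z - pot mu g x) (pot mu g x - pot nu g x).
have := ler_normD (pot mu g z - pot nu g x) (pot nu g x - pot nu g z).
rewrite !addrA !subrK (distrC (pot mu g z) (pot mu g x)).
by lra.
Qed.

End Concentrated.

(** * The Cauchy kernel by real and imaginary parts *)

Section CauchyKernel.
Variable R : realType.
Implicit Types (mu nu : plane_measure R) (p : R * R -> R) (w z : R * R) (e : R).

(** For [p w] equal to [w.1], respectively [- w.2], this is the real, respectively imaginary, part
    of [1/w]. *)
Definition kernel_of p w : R := p w / sqnorm w.

Definition kernel_trunc p e w : R := p w / Num.max (sqnorm w) (e ^+ 2).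

(** The common properties of [w.1] and [- w.2] from which all the kernel estimates follow, so that
    each is proved once for both parts. *)
Definition coord_like p := continuous p /\ forall w, `|p w| <= `|w|.

Lemma coord_like_fst : coord_like (fun w : R * R => w.1).
Proof.
by split; [exact: continuous_fst_plane|move=> w; rewrite normP_max le_max lexx].
Qed.

Lemma coord_like_oppsnd : coord_like (fun w : R * R => - w.2).
Proof.
split => [w|w]; last by rewrite normrN normP_max le_max lexx orbT.
by apply: cvgN; exact: continuous_snd_plane.
Qed.

Lemma measurable_kernel_of p : coord_like p ->
  measurable_fun setT (kernel_of p : plane R -> R).
Proof.
move=> [cp _]; apply: measurable_funM; first exact: continuous_measurable_plane.
apply: measurable_inv_nneg; last exact: sqnorm_ge0.
by apply: continuous_measurable_plane; exact: continuous_sqnorm.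
Qed.

Lemma max_sqnorm_gt0 e w : 0 < e -> 0 < Num.max (sqnorm w) (e ^+ 2).
Proof. by move=> e0; rewrite lt_max exprn_gt0 ?orbT. Qed.

Lemma continuous_kernel_trunc p e : 0 < e -> coord_like p ->
  continuous (kernel_trunc p e).
Proof.
move=> e0 [cp _] w; apply: cvgM; first exact: cp.
apply: cvgV; first by rewrite gt_eqF// max_sqnorm_gt0.
have cm : continuous ((@sqnorm R) \max (cst (e ^+ 2))).
  apply: max_fun_continuous; first exact: continuous_sqnorm.
  by move=> x; exact: cvg_cst.
exact: cm.
Qed.

Lemma kernel_trunc_le p e w : 0 < e -> coord_like p -> `|kernel_trunc p e w| <= e^-1.
Proof.
move=> e0 [_ pw]; have m0 := max_sqnorm_gt0 w e0.
rewrite normrM normfV (gtr0_norm m0) ler_pdivrMr// mulrC ler_pdivlMr//.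
apply: le_trans (_ : `|w| * e <= _); first by rewrite ler_wpM2r// ltW.
have [we|ew] := leP `|w| e.
  by rewrite le_max expr2 ler_wpM2r ?orbT// ltW.
rewrite le_max; apply/orP; left; apply: le_trans (norm_le_sqnorm w).
by rewrite expr2 ler_wpM2l// ltW.
Qed.

(** The kernels coincide for [|w| >= e], as the sup norm is at most the Euclidean one. Inside, the
    difference of the two inverses is at most the larger, which leaves [|w| / |w|^2]. At 0
    everything is 0. *)
Lemma kernel_of_trunc p e w : 0 < e -> coord_like p ->
  `|kernel_of p w - kernel_trunc p e w| <= spike e w.
Proof.
move=> e0 [_ pw]; have m0 := max_sqnorm_gt0 w e0.
have [w0|wn0] := eqVneq `|w| 0.
  have p0 : p w = 0 by apply/normr0_eq0/eqP; rewrite eq_le normr_ge0 andbT -w0 pw.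
  by rewrite /kernel_of /kernel_trunc p0 !mul0r subrr normr0 spike_ge0.
have w0 : 0 < `|w| by rewrite lt_def wn0 normr_ge0.
have n0 : 0 < sqnorm w by apply: lt_le_trans (norm_le_sqnorm w); rewrite exprn_gt0.
rewrite /spike; case: ifPn => [we|]; last first.
  rewrite -leNgt => ew; rewrite /kernel_of /kernel_trunc max_l ?subrr ?normr0//.
  by apply: le_trans (norm_le_sqnorm w); rewrite ler_pXn2r ?nnegrE// ltW.
rewrite /kernel_of /kernel_trunc -mulrBr normrM.
have d0 : 0 <= (sqnorm w)^-1 - (Num.max (sqnorm w) (e ^+ 2))^-1.
  by rewrite subr_ge0 lef_pV2 ?posrE// le_max lexx.
rewrite (ger0_norm d0).
apply: le_trans (_ : `|w| * (sqnorm w)^-1 <= _).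
  by apply: ler_pM => //; rewrite gerBl invr_ge0 ltW.
by rewrite ler_pdivrMr// mulrC ler_pdivlMr// -expr2 norm_le_sqnorm.
Qed.

Lemma cauchy_transformE mu z : cauchy_transform mu z =
  (pot mu (kernel_of (fun w => w.1)) z +i* pot mu (kernel_of (fun w => - w.2)) z)%C.
Proof.
rewrite /cauchy_transform /Cintegral; congr (_ +i* _)%C; apply: eq_Rintegral => zeta _.
by rewrite /kernel_of /sqnorm /= mulNr.
Qed.

Lemma measurable_pot_kernel p mu : coord_like p ->
  measurable_fun setT (pot mu (kernel_of p) : plane R -> R).
Proof. by move=> cp; apply: measurable_pot; exact: measurable_kernel_of. Qed.

Lemma measurable_kernel_trunc p e : 0 < e -> coord_like p ->
  measurable_fun setT (kernel_trunc p e : plane R -> R).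
Proof. by move=> e0 cp; apply: continuous_measurable_plane; exact: continuous_kernel_trunc. Qed.

Lemma pot_kernel_trunc p mu e z : 0 < e -> coord_like p ->
  (`|pot mu (kernel_of p) z - pot mu (kernel_trunc p e) z|%:E <= spike_pot e mu z)%E.
Proof.
move=> e0 cp; apply: (@pot_truncate _ _ _ _ _ e^-1).
- exact: measurable_kernel_of.
- exact: measurable_kernel_trunc.
- by move=> w; exact: kernel_trunc_le.
- by move=> w; exact: kernel_of_trunc.
Qed.

(** Each truncation is paid for by the mass of its measure; between the truncated potentials, the
    uniform bound [s] is integrated over [K]. *)
Lemma integral_pot_close p mu nu (K : set (R * R)) e (s : R) : 0 < e -> 0 <= s ->
  coord_like p -> measurable (K : set (plane R)) ->
  (forall z, K z -> `|pot mu (kernel_trunc p e) z - pot nu (kernel_trunc p e) z| <= s) ->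
  (\int[dA R]_(z in K) `|pot mu (kernel_of p) z - pot nu (kernel_of p) z|%:E <=
    (16 * e)%:E * mu setT + (16 * e)%:E * nu setT + s%:E * dA R K)%E.
Proof.
move=> e0 s0 cp mK hs.
pose g mu := spike_pot e mu : plane R -> \bar R.
have mg mu' : measurable_fun K (g mu').
  by apply: measurable_funTS; exact: measurable_spike_pot.
have g0 mu' z : K z -> (0 <= g mu' z)%E by move=> _; exact: spike_pot_ge0.
have mg2 : measurable_fun K (g mu \+ g nu)%E by exact: emeasurable_funD.
have gK mu' : (\int[dA R]_(z in K) g mu' z <= (16 * e)%:E * mu' setT)%E.
  apply: le_trans (integral_spike_pot mu' e0).
  apply: ge0_subset_integral => //; first exact: measurable_spike_pot.
  by move=> z _; exact: spike_pot_ge0.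
apply: (@le_trans _ _ (\int[dA R]_(z in K) ((g mu \+ g nu) z + s%:E))%E).
  apply: ge0_le_integral => //.
  - apply/measurable_EFinP; apply: measurableT_comp => //; apply: measurable_funTS.
    by apply: measurable_funB; exact: measurable_pot_kernel.
  - by apply: emeasurable_funD.
  move=> z Kz /=.
  have h1 := pot_kernel_trunc mu z e0 cp; have h2 := pot_kernel_trunc nu z e0 cp.
  rewrite /g; have := hs z Kz; move: h1 h2.
  set a1 := pot mu _ z; set b1 := pot mu _ z; set a2 := pot nu _ z; set b2 := pot nu _ z.
  move=> h1 h2 h3.
  apply: le_trans (leeD (leeD h1 h2) (_ : `|b1 - b2|%:E <= s%:E)%E); last by rewrite lee_fin.
  rewrite -!EFinD lee_fin (_ : a1 - a2 = (a1 - b1) - (a2 - b2) + (b1 - b2)); last by ring.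
  by apply: le_trans (ler_normD _ _) _; rewrite lerD2r ler_normB.
rewrite ge0_integralD//; last first.
  by move=> z Kz; rewrite adde_ge0// g0.
rewrite integral_cst// leeD2r// ge0_integralD//; do ?by move=> z Kz; exact: g0.
- by rewrite leeD.
- exact: mg.
- exact: mg.
Qed.

(** Truncation at scale 1: the truncated kernel is bounded by 1, so its potential is at most the
    mass, and the error costs 16 times the mass. *)
Lemma integral_pot_bound p mu (K : set (R * R)) :
  coord_like p -> measurable (K : set (plane R)) ->
  (\int[dA R]_(z in K) `|pot mu (kernel_of p) z|%:E <=
    16%:E * mu setT + mu setT * dA R K)%E.
Proof.
move=> cp mK; have e1 : 0 < 1 :> R by [].
pose s := fine (mu setT).
have muE : mu setT = s%:E by rewrite /s fineK// fin_num_measure.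
have mg : measurable_fun K (spike_pot 1 mu : plane R -> \bar R).
  by apply: measurable_funTS; exact: measurable_spike_pot.
apply: (@le_trans _ _ (\int[dA R]_(z in K) (spike_pot 1 mu z + s%:E))%E).
  apply: ge0_le_integral => //.
  - apply/measurable_EFinP; apply: measurableT_comp => //; apply: measurable_funTS.
    exact: measurable_pot_kernel.
  - by apply: emeasurable_funD.
  move=> z Kz /=.
  have h1 := pot_kernel_trunc mu z e1 cp.
  have := pot_bounded mu z (measurable_kernel_trunc e1 cp)
    (fun w => kernel_trunc_le w e1 cp).
  rewrite invr1 mul1e muE => h2; apply: le_trans (leeD h1 h2).
  rewrite -EFinD lee_fin; apply: le_trans (ler_normD _ _).
  by rewrite subrK.
rewrite ge0_integralD//; do ?by move=> z Kz; exact: spike_pot_ge0.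
2: by move=> z _; rewrite lee_fin fine_ge0.
rewrite integral_cst// -muE leeD2r//.
apply: le_trans (_ : _ <= \int[dA R]_z spike_pot 1 mu z)%E _.
  apply: ge0_subset_integral => //; first exact: measurable_spike_pot.
  by move=> z _; exact: spike_pot_ge0.
by apply: le_trans (integral_spike_pot mu e1) _; rewrite mulr1.
Qed.

End CauchyKernel.

(** * The modulus of the defining polynomial *)

Section ComplexModulus.
Variable R : realType.
Implicit Types x y : R[i].
Local Notation normc := (@Normc.normc R).

Lemma normcE x : (normc x)%:C%C = `|x|.
Proof. by case: x. Qed.

Lemma normc_ge0 x : 0 <= normc x.
Proof. by case: x => a b /=; exact: sqrtr_ge0. Qed.

Lemma ler_normcD x y : normc (x + y) <= normc x + normc y.
Proof. by rewrite -lecR rmorphD /= !normcE ler_normD. Qed.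

Lemma normcN x : normc (- x) = normc x.
Proof. by apply: (@complexI R); rewrite !normcE normrN. Qed.

Lemma normcX x n : normc (x ^+ n) = normc x ^+ n.
Proof. by elim: n => [|n IH]; rewrite ?expr0 ?Normc.normc1// !exprS Normc.normcM IH. Qed.

Lemma ler_normc_sum I (r : seq I) (P : pred I) (F : I -> R[i]) :
  normc (\sum_(i <- r | P i) F i) <= \sum_(i <- r | P i) normc (F i).
Proof.
elim/big_ind2 : _ => // [|x1 x2 y1 y2 h1 h2]; first by rewrite Normc.normc0.
by apply: le_trans (ler_normcD _ _) _; exact: lerD.
Qed.

Lemma normc_real (a : R) : normc (a%:C%C) = `|a|.
Proof. by rewrite /= expr0n /= addr0 sqrtr_sqr. Qed.

Lemma normr_Re_le x : `|complex.Re x| <= normc x.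
Proof.
by case: x => a b /=; rewrite -sqrtr_sqr ler_wsqrtr// lerDl sqr_ge0.
Qed.

Lemma normr_Im_le x : `|complex.Im x| <= normc x.
Proof.
by case: x => a b /=; rewrite -sqrtr_sqr ler_wsqrtr// lerDr sqr_ge0.
Qed.

Lemma normc_le_ReIm x : normc x <= `|complex.Re x| + `|complex.Im x|.
Proof.
case: x => a b /=; rewrite -[leRHS]ger0_norm ?addr_ge0// -[leRHS]sqrtr_sqr.
rewrite ler_wsqrtr// sqrrD !real_normK ?num_real// -addrA lerD2l lerDr.
by rewrite mulrn_wge0// mulr_ge0.
Qed.

End ComplexModulus.

Lemma superadditive_exprn (R : realDomainType) (u v : R) n : 0 <= u -> 0 <= v ->
  u ^+ n.+1 + v ^+ n.+1 <= (u + v) ^+ n.+1.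
Proof.
move=> u0 v0; elim: n => [|n IH]; first by rewrite !expr1.
rewrite [leRHS]exprS; apply: le_trans (ler_wpM2l (addr_ge0 u0 v0) IH).
rewrite mulrDl !mulrDr -!exprS -addrA lerD2l addrA lerDr.
by rewrite addr_ge0// mulr_ge0// exprn_ge0.
Qed.

(** The Hölder continuity of the [n.+1]-th root, written without roots; it follows from
    superadditivity applied to [u - v] and [v]. *)
Lemma normr_sub_exprn (R : realDomainType) (u v : R) n : 0 <= u -> 0 <= v ->
  `|u - v| ^+ n.+1 <= `|u ^+ n.+1 - v ^+ n.+1|.
Proof.
wlog uv : u v / v <= u => [H u0 v0|u0 v0].
  have [vu|/ltW uv] := leP v u; first exact: H.
  by rewrite distrC (distrC (u ^+ _)); apply: H.
have uv0 : 0 <= u - v by rewrite subr_ge0.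
rewrite ger0_norm// ger0_norm; last by rewrite subr_ge0 ler_pXn2r.
by have := superadditive_exprn n uv0 v0; rewrite subrK -lerBrDr.
Qed.

Section Modulus.
Variable R : realType.
Implicit Types (P : {poly {poly R[i]}}) (q : {poly R[i]}) (z w : R[i]).
Local Notation normc := (@Normc.normc R).

Lemma eval2E P z w : eval2 P z w = \sum_(i < size P) (P`_i).[z] * w ^+ i.
Proof.
rewrite /eval2 (horner_coef P) horner_sum; apply: eq_bigr => i _.
by rewrite hornerM horner_exp hornerC.
Qed.

Lemma horner_bounded q (rho : R) : exists B, forall z, normc z <= rho -> normc q.[z] <= B.
Proof.
exists (\sum_(i < size q) normc q`_i * `|rho| ^+ i) => z zr.
rewrite horner_coef; apply: le_trans (ler_normc_sum _ _ _) _.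
apply: ler_sum => i _; rewrite Normc.normcM normcX ler_wpM2l ?normc_ge0//.
by rewrite lerXn2r ?nnegrE ?normc_ge0// (le_trans zr)// ler_norm.
Qed.

Lemma coefs_bounded P (rho : R) : exists2 B, 0 <= B &
  forall i z, normc z <= rho -> normc (P`_i).[z] <= B.
Proof.
have [B hB] := choice (fun i : nat => horner_bounded P`_i rho).
have B0 (i : nat) : 0 <= Num.max (B i) 0 by rewrite le_max lexx orbT.
exists (\sum_(i < size P) Num.max (B i) 0); first exact: sumr_ge0.
move=> i z zr; have [iP|Pi] := ltnP i (size P).
  apply: le_trans (hB i z zr) _; rewrite (bigD1 (Ordinal iP))//=.
  by rewrite ler_wpDr ?sumr_ge0// le_max lexx.
by rewrite nth_default// horner0 Normc.normc0 sumr_ge0.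
Qed.

(** By telescoping. For [i = 0] the predecessor is harmless, since the factor [i%:R] vanishes. *)
Lemma normc_subX w w' S i : normc w <= S -> normc w' <= S ->
  normc (w ^+ i - w' ^+ i) <= i%:R * normc (w - w') * S ^+ i.-1.
Proof.
move=> wS w'S; have S0 : 0 <= S by apply: le_trans wS; exact: normc_ge0.
elim: i => [|i IH]; first by rewrite !expr0 subrr Normc.normc0 !mul0r.
have -> : w ^+ i.+1 - w' ^+ i.+1 = w * (w ^+ i - w' ^+ i) + (w - w') * w' ^+ i.
  by rewrite !exprS; ring.
apply: le_trans (ler_normcD _ _) _; rewrite !Normc.normcM normcX -natr1.
rewrite !mulrDl mul1r /=; apply: lerD; last first.
  by rewrite ler_wpM2l ?normc_ge0// lerXn2r ?nnegrE ?normc_ge0.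
apply: le_trans (ler_pM (normc_ge0 _) (normc_ge0 _) wS IH) _.
case: i {IH} => [|i]; rewrite ?mul0r ?mulr0//= exprS.
by rewrite le_eqVlt; apply/orP; left; apply/eqP; ring.
Qed.

Section Degree.
Variables (P : {poly {poly R[i]}}) (d : nat).
Hypothesis dP : degw P = d.+1.

Let sizeP : size P = d.+2.
Proof. by move: dP; rewrite /degw; case: (size P) => //= n ->. Qed.

Lemma eval2_bound rho : exists2 C, 0 <= C & forall z w, normc z <= rho ->
  normc (eval2 P z w) <= C * (1 + normc w) ^+ d.+1.
Proof.
have [B B0 hB] := coefs_bounded P rho.
exists (d.+2%:R * B) => [|z w zr]; first exact: mulr_ge0.
rewrite eval2E sizeP; apply: le_trans (ler_normc_sum _ _ _) _.
apply: (@le_trans _ _ (\sum_(i < d.+2) B * (1 + normc w) ^+ d.+1)).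
  apply: ler_sum => i _; rewrite Normc.normcM normcX ler_pM ?normc_ge0 ?exprn_ge0 ?normc_ge0 ?hB//.
  apply: le_trans (_ : (1 + normc w) ^+ i <= _).
    by rewrite lerXn2r ?nnegrE ?addr_ge0 ?normc_ge0// lerDr.
  by rewrite ler_weXn2l// ?lerDl ?normc_ge0// -ltnS ltn_ord.
by rewrite sumr_const card_ord -mulrA mulr_natl.
Qed.

Lemma eval2_lipschitz rho : exists2 C, 0 <= C & forall z w w', normc z <= rho ->
  normc (eval2 P z w - eval2 P z w') <=
    C * normc (w - w') * (1 + normc w + normc w') ^+ d.
Proof.
have [B B0 hB] := coefs_bounded P rho.
exists (d.+2%:R * (B * d.+1%:R)) => [|z w w' zr]; first by rewrite !mulr_ge0.
set S := 1 + normc w + normc w'.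
have S1 : 1 <= S by rewrite /S -addrA lerDl addr_ge0 ?normc_ge0.
have wS : normc w <= S by rewrite /S -addrA addrCA lerDl addr_ge0 ?normc_ge0.
have w'S : normc w' <= S by rewrite /S lerDr addr_ge0 ?normc_ge0.
rewrite !eval2E sizeP -sumrB; apply: le_trans (ler_normc_sum _ _ _) _.
apply: (@le_trans _ _ (\sum_(i < d.+2) B * (d.+1%:R * normc (w - w') * S ^+ d))).
  apply: ler_sum => i _; rewrite -mulrBr Normc.normcM ler_pM ?normc_ge0 ?hB//.
  apply: le_trans (normc_subX i wS w'S) _.
  apply: ler_pM; rewrite ?mulr_ge0 ?normc_ge0 ?exprn_ge0 ?(le_trans _ S1)//.
    by rewrite ler_wpM2r ?normc_ge0// ler_nat -ltnS ltn_ord.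
  by rewrite ler_weXn2l// -ltnS; case: i => -[|i] //=.
by rewrite sumr_const card_ord -[leLHS]mulr_natl !mulrA.
Qed.

Definition rooted z w : R := normc (eval2 P z w) `^ (degw P)%:R^-1.

Lemma rooted_ge0 z w : 0 <= rooted z w.
Proof. exact: powR_ge0. Qed.

Lemma rootedX z w : rooted z w ^+ d.+1 = normc (eval2 P z w).
Proof.
by rewrite /rooted dP -powR_mulrn ?powR_ge0// -powRrM mulVf ?pnatr_eq0// powRr1 ?normc_ge0.
Qed.

Let le_expS (c : R) : 1 <= c -> c <= c ^+ d.+1.
Proof. by move=> c1; rewrite exprS ler_peMr ?exprn_ege1// (le_trans _ c1). Qed.

(** The root reduces the growth in [w] to a linear one. Taking [1 + C] as constant avoids extracting
    a root: [C <= 1 + C <= (1 + C) ^+ d.+1]. *)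
Lemma rooted_bound rho : exists2 C, 0 <= C & forall z w, normc z <= rho ->
  rooted z w <= C * (1 + normc w).
Proof.
have [C C0 hC] := eval2_bound rho.
have C1 : 1 <= 1 + C by rewrite lerDl.
exists (1 + C) => [|z w zr]; first by rewrite addr_ge0.
rewrite -(@ler_pXn2r _ d.+1)// ?nnegrE ?rooted_ge0 ?mulr_ge0 ?addr_ge0 ?normc_ge0//.
rewrite rootedX exprMn; apply: le_trans (hC z w zr) _.
rewrite ler_wpM2r ?exprn_ge0 ?addr_ge0 ?normc_ge0//.
by apply: le_trans (le_expS C1); rewrite lerDr.
Qed.

(* The d-th root is only 1/d-Hoelder, but at the cost of a small multiple of
   [1 + |w| + |w'|] it is Lipschitz, by Young's inequality. *)
Lemma rooted_modulus rho eta : 0 < eta -> exists2 C, 0 <= C &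
  forall z w w', normc z <= rho ->
  `|rooted z w - rooted z w'| <=
    eta * (1 + (normc w + normc w')) + C * normc (w - w').
Proof.
move=> eta0; have [C C0 hC] := eval2_lipschitz rho.
pose c := 1 + C; have c1 : 1 <= c by rewrite lerDl.
have c0 : 0 < c by apply: lt_le_trans c1.
pose h := (eta / c) ^+ d.+1; have h0 : 0 < h by rewrite exprn_gt0// divr_gt0.
pose L := 1 + h^-1; have L1 : 1 <= L by rewrite lerDl invr_ge0 ltW.
have L0 : 0 <= L by apply: le_trans L1.
exists (c * L) => [|z w w' zr]; first by rewrite mulr_ge0// ltW.
rewrite addrA; set S := 1 + normc w + normc w'; set t := normc (w - w').
have S0 : 0 <= S by rewrite !addr_ge0 ?normc_ge0.
have t0 : 0 <= t by exact: normc_ge0.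
have key : `|rooted z w - rooted z w'| ^+ d.+1 <= C * t * S ^+ d.
  apply: le_trans (normr_sub_exprn d (rooted_ge0 _ _) (rooted_ge0 _ _)) _.
  rewrite !rootedX; apply: le_trans (hC z w w' zr).
  rewrite ler_norml; apply/andP; split.
    rewrite lerNl opprB lerBlDr -(normcN (_ - _)) opprB.
    by apply: le_trans (ler_normcD _ _); rewrite subrK.
  by rewrite lerBlDr; apply: le_trans (ler_normcD _ _); rewrite subrK.
have Cc : C <= c ^+ d.+1 by apply: le_trans (le_expS c1); rewrite lerDr.
(* If [t] is small compared with [S], then [C t S^d] is at most [c^(d+1) h S^(d+1)], which is
   [(eta S)^(d+1)] by the choice of [h]. Otherwise [S] is at most [L t], and the bound becomes a
   power of a multiple of [t]. *)
have [tS|St] := leP t (h * S).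
  apply: (@le_trans _ _ (eta * S)); last by rewrite lerDl !mulr_ge0// ltW.
  rewrite -(@ler_pXn2r _ d.+1)// ?nnegrE ?mulr_ge0// ?(ltW eta0)//.
  apply: le_trans key _.
  apply: (@le_trans _ _ (c ^+ d.+1 * (h * S) * S ^+ d)).
    by rewrite ler_wpM2r ?exprn_ge0// ler_pM.
  rewrite /h expr_div_n -mulrA -(mulrA _ S) -exprS mulrA mulrCA mulfV ?mulr1 ?exprMn//.
  by rewrite expf_neq0// gt_eqF.
apply: (@le_trans _ _ (c * L * t)); last by rewrite lerDr mulr_ge0// ltW.
rewrite -(@ler_pXn2r _ d.+1)// ?nnegrE ?mulr_ge0// ?(ltW c0)//.
apply: le_trans key _.
have SL : S <= L * t.
  apply: (@le_trans _ _ (h^-1 * t)); first by rewrite mulrC ler_pdivlMr// mulrC ltW.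
  by rewrite ler_wpM2r// lerDr.
apply: (@le_trans _ _ (c ^+ d.+1 * t * (L * t) ^+ d)).
  apply: ler_pM; rewrite ?mulr_ge0 ?exprn_ge0//; first by rewrite ler_wpM2r.
  by rewrite lerXn2r ?nnegrE ?mulr_ge0.
rewrite -(mulrA c) [leRHS]exprMn -mulrA ler_wpM2l ?exprn_ge0 ?(ltW c0)//.
rewrite [leRHS]exprS ler_wpM2r ?exprn_ge0 ?mulr_ge0//.
by rewrite ler_peMl.
Qed.

End Degree.
End Modulus.

(** * Componentwise measurability of complex functions *)

Section ComplexMeasurable.
Context d (T : measurableType d) (R : realType).
Implicit Types f g : T -> R[i].
Local Notation cRe := (@complex.Re R).
Local Notation cIm := (@complex.Im R).

Definition cmeasurable f := measurable_fun setT (cRe \o f) /\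
  measurable_fun setT (cIm \o f).

Lemma cmeasurable_cst (c : R[i]) : cmeasurable (cst c).
Proof. by split; exact: measurable_cst. Qed.

Lemma cmeasurableD f g : cmeasurable f -> cmeasurable g ->
  cmeasurable (fun x => f x + g x).
Proof.
move=> [rf jf] [rg jg]; split.
- rewrite (_ : _ \o _ = (cRe \o f) \+ (cRe \o g)); first exact: measurable_funD.
  by apply/funext => x /=; case: (f x) => ? ?; case: (g x).
- rewrite (_ : _ \o _ = (cIm \o f) \+ (cIm \o g)); first exact: measurable_funD.
  by apply/funext => x /=; case: (f x) => ? ?; case: (g x).
Qed.

Lemma cmeasurableM f g : cmeasurable f -> cmeasurable g ->
  cmeasurable (fun x => f x * g x).
Proof.
move=> [rf jf] [rg jg]; split.
- rewrite (_ : _ \o _ = ((cRe \o f) \* (cRe \o g)) \-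
    ((cIm \o f) \* (cIm \o g))).
    by apply: measurable_funB; exact: measurable_funM.
  by apply/funext => x /=; case: (f x) => ? ?; case: (g x).
- rewrite (_ : _ \o _ = ((cRe \o f) \* (cIm \o g)) \+
    ((cIm \o f) \* (cRe \o g))).
    by apply: measurable_funD; exact: measurable_funM.
  by apply/funext => x /=; case: (f x) => ? ?; case: (g x).
Qed.

Lemma cmeasurableX f n : cmeasurable f -> cmeasurable (fun x => f x ^+ n).
Proof.
move=> mf; elim: n => [|n IH]; first exact: cmeasurable_cst.
rewrite (_ : (fun x => _) = fun x => f x * f x ^+ n); first exact: cmeasurableM.
by apply/funext => x; rewrite exprS.
Qed.

Lemma cmeasurable_sum n (F : nat -> T -> R[i]) : (forall i, cmeasurable (F i)) ->
  cmeasurable (fun x => \sum_(i < n) F i x).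
Proof.
move=> mF; elim: n => [|n IH].
  rewrite (_ : (fun x => _) = cst 0); first exact: cmeasurable_cst.
  by apply/funext => x; rewrite big_ord0.
rewrite (_ : (fun x => _) = fun x => \sum_(i < n) F i x + F n x).
  exact: cmeasurableD.
by apply/funext => x; rewrite big_ord_recr.
Qed.

Lemma cmeasurable_horner (q : {poly R[i]}) f : cmeasurable f ->
  cmeasurable (fun x => q.[f x]).
Proof.
move=> mf; rewrite (_ : (fun x => _) = fun x => \sum_(i < size q) q`_i * f x ^+ i).
  apply: (@cmeasurable_sum _ (fun i x => q`_i * f x ^+ i)) => i.
  by apply: cmeasurableM; [exact: cmeasurable_cst|exact: cmeasurableX].
by apply/funext => x; rewrite horner_coef.
Qed.

Lemma cmeasurable_eval2 (P : {poly {poly R[i]}}) f g : cmeasurable f -> cmeasurable g ->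
  cmeasurable (fun x => eval2 P (f x) (g x)).
Proof.
move=> mf mg; rewrite (_ : (fun x => _) = fun x => \sum_(i < size P) (P`_i).[f x] * g x ^+ i).
  apply: (@cmeasurable_sum _ (fun i x => (P`_i).[f x] * g x ^+ i)) => i.
  by apply: cmeasurableM; [exact: cmeasurable_horner|exact: cmeasurableX].
by apply/funext => x; rewrite eval2E.
Qed.

Lemma measurable_normc f : cmeasurable f ->
  measurable_fun setT (fun x => Normc.normc (f x)).
Proof.
move=> [rf jf].
rewrite (_ : (fun x => _) = @Num.sqrt R \o
  (fun x => (cRe \o f) x ^+ 2 + (cIm \o f) x ^+ 2)).
  apply: measurableT_comp.
    by apply: continuous_measurable_fun; exact: sqrt_continuous.
  by apply: measurable_funD; exact: measurable_funX.
by apply/funext => x /=; case: (f x).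
Qed.

End ComplexMeasurable.

Lemma cmeasurable_toC (R : realType) : cmeasurable (@toC R : plane R -> R[i]).
Proof. by split; [exact: measurable_fst|exact: measurable_snd]. Qed.

(** * Continuity of the defect *)

Lemma fine_leD (R : realDomainType) (x y : \bar R) (e : R) :
  x \is a fin_num -> y \is a fin_num -> (x <= y + e%:E)%E -> fine x <= fine y + e.
Proof. by case: x; case: y. Qed.

Lemma distr_le_intro (R : realDomainType) (x y e : R) :
  y <= x + e -> x <= y + e -> `|x - y| <= e.
Proof. by rewrite ler_distl lerBlDr => -> ->. Qed.

Section DefectEstimates.
Variables (R : realType) (K : set (R * R)) (a : R) (P : {poly {poly R[i]}}) (d : nat).
Hypotheses (cK : compact K) (dP : degw P = d.+1).
Implicit Types (mu nu : plane_measure R) (f g : R * R -> R).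
Local Notation normc := (@Normc.normc R).
Local Notation C := (@cauchy_transform R).
Local Notation pre := (fun w : R * R => w.1).
Local Notation pim := (fun w : R * R => - w.2).
Local Notation kre := (kernel_of pre).
Local Notation kim := (kernel_of pim).

Let mK : measurable (K : set (plane R)) := compact_measurable_plane cK.

Lemma compact_normc_bounded : exists rho : R, forall z, K z -> normc (toC z) <= rho.
Proof.
have /compact_bounded[M [_ hM]] := cK; exists ((M + 1) + (M + 1)) => z Kz.
have zM : `|z| <= M + 1 by apply: hM => //; rewrite ltrDl.
apply: le_trans (normc_le_ReIm (toC z)) _ => /=.
by apply: lerD; apply: le_trans zM; rewrite normP_max le_max lexx ?orbT.
Qed.

Lemma area_compact_fin_num : dA R K \is a fin_num.
Proof.
have /compact_bounded[M [_ hM]] := cK.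
have M0 : 0 <= `|M| + 2 by rewrite addr_ge0.
rewrite ge0_fin_numE//; apply: (@le_lt_trans _ _ (dA R (ball (0 : R * R) (`|M| + 2)))).
  apply: le_measure; rewrite ?inE//; first by apply: open_measurable_plane; exact: ball_open.
  move=> z Kz; rewrite -ball_normE /= sub0r normrN.
  apply: le_lt_trans (hM (`|M| + 1) _ z Kz) _; last by rewrite ltrD2l ltr1n.
  by rewrite (le_lt_trans (ler_norm M))// ltrDl.
by rewrite area_ball// ltry.
Qed.

Let ar := fine (dA R K).

Let arE : dA R K = ar%:E.
Proof. by rewrite /ar fineK// area_compact_fin_num. Qed.

Let ar0 : 0 <= ar.
Proof. by rewrite fine_ge0. Qed.

Local Notation J f := (\int[dA R]_(z in K) (f z)%:E)%E.
Let mT f := measurable_fun setT (f : plane R -> R).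

Let m1 : mT (fun=> 1). Proof. exact: measurable_cst. Qed.

Let JD f g : mT f -> mT g -> (forall z, 0 <= f z) -> (forall z, 0 <= g z) ->
  J (fun z => f z + g z) = (J f + J g)%E.
Proof.
move=> mf mg f0 g0; under eq_integral do rewrite EFinD.
rewrite ge0_integralD//; do ?(by move=> z _; rewrite lee_fin);
  by apply/measurable_EFinP; exact: measurable_funTS.
Qed.

Let JZ f (c : R) : 0 <= c -> mT f -> (forall z, 0 <= f z) ->
  J (fun z => c * f z) = (c%:E * J f)%E.
Proof.
move=> c0 mf f0; under eq_integral do rewrite EFinM.
rewrite ge0_integralZl//; do ?(by move=> z _; rewrite lee_fin).
by apply/measurable_EFinP; exact: measurable_funTS.
Qed.

Let Jle f g : mT f -> mT g -> (forall z, 0 <= f z) -> (forall z, K z -> f z <= g z) ->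
  (J f <= J g)%E.
Proof.
move=> mf mg f0 fg; apply: ge0_le_integral => //;
  do ?(by apply/measurable_EFinP; exact: measurable_funTS);
  move=> z Kz; rewrite lee_fin//; exact: fg.
Qed.

Let J1 : J (fun=> 1) = ar%:E.
Proof. by rewrite integral_cst// mul1e -arE. Qed.

Lemma measurable_rooted_cauchy mu :
  measurable_fun setT ((fun z => rooted P (toC z) (C mu z)) : plane R -> R).
Proof.
apply: (measurableT_comp (measurable_powR _)).
apply: measurable_normc; apply: cmeasurable_eval2; first exact: cmeasurable_toC.
split.
- rewrite (_ : _ \o _ = (pot mu kre : plane R -> R)).
    by apply: measurable_pot_kernel; exact: coord_like_fst.
  by apply/funext => z; rewrite /comp cauchy_transformE.
- rewrite (_ : _ \o _ = (pot mu kim : plane R -> R)).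
    by apply: measurable_pot_kernel; exact: coord_like_oppsnd.
  by apply/funext => z; rewrite /comp cauchy_transformE.
Qed.

(** [sz] and [ds] majorize the moduli of [C mu z] and of [C mu z - C nu z] by sums over the two real
    kernels, whose area integrals are controlled above. *)
Let sz mu z := `|pot mu kre z| + `|pot mu kim z|.
Let ds mu nu z := `|pot mu kre z - pot nu kre z| + `|pot mu kim z - pot nu kim z|.

Let mpot p mu : coord_like p -> mT (fun z => `|pot mu (kernel_of p) z|).
Proof. by move=> cp; apply: measurableT_comp => //; exact: measurable_pot_kernel. Qed.

Let mpotB p mu nu : coord_like p ->
  mT (fun z => `|pot mu (kernel_of p) z - pot nu (kernel_of p) z|).
Proof.
by move=> cp; apply: measurableT_comp => //; apply: measurable_funB; exact: measurable_pot_kernel.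
Qed.

Let cre : coord_like (fun w : R * R => w.1) := coord_like_fst R.
Let cim : coord_like (fun w : R * R => - w.2) := coord_like_oppsnd R.

Let msz mu : mT (sz mu).
Proof. by apply: measurable_funD; exact: mpot. Qed.

Let mds mu nu : mT (ds mu nu).
Proof. by apply: measurable_funD; exact: mpotB. Qed.

Let sz0 mu z : 0 <= sz mu z. Proof. by rewrite addr_ge0. Qed.
Let ds0 mu nu z : 0 <= ds mu nu z. Proof. by rewrite addr_ge0. Qed.

Let normc_sz mu z : normc (C mu z) <= sz mu z.
Proof. by apply: le_trans (normc_le_ReIm _) _; rewrite cauchy_transformE. Qed.

Let normc_ds mu nu z : normc (C mu z - C nu z) <= ds mu nu z.
Proof. by apply: le_trans (normc_le_ReIm _) _; rewrite !cauchy_transformE. Qed.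

Let Jsz mu : mu setT = a%:E -> (J (sz mu) <= (2 * (16 * a + a * ar))%:E)%E.
Proof.
move=> muT; rewrite JD//; do ?exact: mpot.
rewrite mulrDl mul1r EFinD; apply: leeD.
- by apply: le_trans (integral_pot_bound mu cre mK) _; rewrite muT arE -!EFinM -EFinD.
- by apply: le_trans (integral_pot_bound mu cim mK) _; rewrite muT arE -!EFinM -EFinD.
Qed.

Let Jds mu nu (e s : R) : 0 < e -> 0 <= s -> mu setT = a%:E -> nu setT = a%:E ->
  (forall z, K z -> `|pot mu (kernel_trunc pre e) z - pot nu (kernel_trunc pre e) z| <= s) ->
  (forall z, K z -> `|pot mu (kernel_trunc pim e) z - pot nu (kernel_trunc pim e) z| <= s) ->
  (J (ds mu nu) <= (2 * (32 * e * a + s * ar))%:E)%E.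
Proof.
move=> e0 s0 muT nuT h1 h2; rewrite JD//; do ?exact: mpotB.
have -> : 2 * (32 * e * a + s * ar) = (16 * e * a + 16 * e * a + s * ar) +
  (16 * e * a + 16 * e * a + s * ar) by ring.
rewrite EFinD; apply: leeD.
- apply: le_trans (integral_pot_close e0 s0 cre mK h1) _.
  by rewrite muT nuT arE -!EFinM -!EFinD.
- apply: le_trans (integral_pot_close e0 s0 cim mK h2) _.
  by rewrite muT nuT arE -!EFinM -!EFinD.
Qed.

Lemma defectE mu : defect P K mu = J (fun z => rooted P (toC z) (C mu z)).
Proof. by []. Qed.

Lemma defect_ge0 mu : (0 <= defect P K mu)%E.
Proof. by apply: integral_ge0 => z _; rewrite lee_fin powR_ge0. Qed.

Lemma defect_fin_num mu : mu setT = a%:E -> defect P K mu \is a fin_num.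
Proof.
move=> muT; rewrite ge0_fin_numE ?defect_ge0// defectE.
have [rho hrho] := compact_normc_bounded.
have [c c0 hc] := rooted_bound dP rho.
apply: (@le_lt_trans _ _ (J (fun z => c * (1 + sz mu z)))).
  apply: Jle; [exact: measurable_rooted_cauchy| |by move=> z; exact: powR_ge0|].
    by apply: measurable_funM => //; apply: measurable_funD => //; exact: msz.
  move=> z Kz; apply: le_trans (hc _ _ (hrho z Kz)) _.
  by rewrite ler_wpM2l// lerD2l normc_sz.
rewrite JZ//; last 2 first.
- by apply: measurable_funD => //; exact: msz.
- by move=> z; rewrite addr_ge0// sz0.
rewrite (JD m1 (msz mu) (fun=> ler01) (sz0 mu)).
rewrite J1; apply: (@le_lt_trans _ _ (c%:E * (ar%:E + (2 * (16 * a + a * ar))%:E))%E);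
  last by rewrite -EFinD -EFinM ltry.
by apply: lee_wpmul2l; rewrite ?lee_fin// leeD2l// Jsz.
Qed.

(** One-sided, to be applied a second time with [mu] and [nu] exchanged. That [e] is chosen before
    the measures is the point: it is both the scale of the truncation and the tolerance for the
    truncated potentials. *)
Lemma defect_close eps : 0 < eps -> 0 <= a -> exists2 e, 0 < e &
  forall mu nu, mu setT = a%:E -> nu setT = a%:E ->
  (forall z, K z -> `|pot mu (kernel_trunc pre e) z - pot nu (kernel_trunc pre e) z| <= e) ->
  (forall z, K z -> `|pot mu (kernel_trunc pim e) z - pot nu (kernel_trunc pim e) z| <= e) ->
  (defect P K nu <= defect P K mu + eps%:E)%E.
Proof.
move=> eps0 a0.
have [rho hrho] := compact_normc_bounded.
(* [B] bounds the integral over [K] of [1 + sz mu + sz nu], and [e * M] that of [c * ds mu nu];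
   [eta] and [e] are such that each part costs at most half of [eps]. *)
pose B := ar + 4 * (16 * a + a * ar).
have B0 : 0 <= B by rewrite addr_ge0 ?mulr_ge0 ?addr_ge0 ?mulr_ge0.
pose eta := eps / (2 * (B + 1)).
have eta0 : 0 < eta by rewrite divr_gt0// mulr_gt0// ltr_wpDl.
have [c c0 hc] := rooted_modulus dP rho eta0.
pose M := c * (64 * a + 2 * ar).
have M0 : 0 <= M by rewrite mulr_ge0 ?addr_ge0 ?mulr_ge0.
pose e := eps / (2 * (M + 1)).
have e0 : 0 < e by rewrite divr_gt0// mulr_gt0// ltr_wpDl.
exists e => // mu nu muT nuT hs1 hs2; rewrite !defectE.
pose G z := eta * (1 + (sz mu z + sz nu z)) + c * ds mu nu z.
have msz2 : mT (fun z => sz mu z + sz nu z) by apply: measurable_funD; exact: msz.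
have m1sz2 : mT (fun z => 1 + (sz mu z + sz nu z)) by apply: measurable_funD.
have sz20 z : 0 <= sz mu z + sz nu z by rewrite addr_ge0// sz0.
have m1sz20 z : 0 <= 1 + (sz mu z + sz nu z) by rewrite addr_ge0.
have msz3 : mT (fun z => eta * (1 + (sz mu z + sz nu z))).
  by apply: measurable_funM.
have mcds : mT (fun z => c * ds mu nu z).
  by apply: measurable_funM => //; exact: mds.
have G1 z : 0 <= eta * (1 + (sz mu z + sz nu z)) by rewrite mulr_ge0 ?(ltW eta0)// addr_ge0.
have G2 z : 0 <= c * ds mu nu z by rewrite mulr_ge0// ds0.
have mG : mT G by exact: measurable_funD.
have G0 z : 0 <= G z by rewrite addr_ge0.
have JG : (J G <= eps%:E)%E.
  rewrite JD// (JZ (ltW eta0) m1sz2 m1sz20).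
  rewrite (JD m1 msz2 (fun=> ler01) sz20) (JD (msz mu) (msz nu))//; do ?exact: sz0.
  rewrite J1 (JZ c0 (mds mu nu) (ds0 mu nu)).
  apply: (@le_trans _ _ (eta%:E * (ar%:E + ((2 * (16 * a + a * ar))%:E +
      (2 * (16 * a + a * ar))%:E)) + c%:E * (2 * (32 * e * a + e * ar))%:E)%E).
    apply: leeD.
      apply: lee_wpmul2l; first by rewrite lee_fin ltW.
      by rewrite leeD2l// leeD// Jsz.
    by apply: lee_wpmul2l => //; apply: Jds => //; exact: ltW.
  rewrite -!EFinD lee_fin.
  have -> : eps = eta * (B + 1) + e * (M + 1).
    by rewrite /eta /e; field; rewrite !gt_eqF// ltr_wpDl.
  rewrite -subr_ge0 (_ : _ - _ = eta + e); last by rewrite /B /M; ring.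
  by rewrite addr_ge0// ltW.
apply: (@le_trans _ _ (J (fun z => rooted P (toC z) (C mu z) + G z))).
  apply: Jle => //; do ?exact: measurable_rooted_cauchy; do ?by move=> z; exact: powR_ge0.
    by apply: measurable_funD => //; exact: measurable_rooted_cauchy.
  move=> z Kz; have := hc _ (C mu z) (C nu z) (hrho z Kz).
  have h1 : eta * (1 + (normc (C mu z) + normc (C nu z))) <= eta * (1 + (sz mu z + sz nu z)).
    by rewrite ler_wpM2l ?(ltW eta0)// lerD2l lerD// normc_sz.
  have h2 : c * normc (C mu z - C nu z) <= c * ds mu nu z by rewrite ler_wpM2l// normc_ds.
  rewrite ler_norml => /andP[h3 _].
  by rewrite -lerBlDl -[leLHS]opprB lerNl; apply: le_trans h3; rewrite lerN2 /G lerD.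
rewrite JD//; do ?exact: measurable_rooted_cauchy; do ?by move=> z; exact: powR_ge0.
by rewrite leeD2l.
Qed.

(** Only convergence against continuous functions is asked of the filter, so that both weak-star
    neighbourhoods and the ultrafilter of a minimizing sequence are covered. *)
Lemma defect_cvg (F : set_system (plane_measure R)) mu : Filter F ->
  mu (~` K) = 0%E -> mu setT = a%:E ->
  F [set nu : plane_measure R | nu (~` K) = 0%E /\ nu setT = a%:E] ->
  (forall h, continuous h ->
    (fun nu : plane_measure R => Rintegral nu setT h) @ F --> Rintegral mu setT h) ->
  defect P K @ F --> defect P K mu.
Proof.
move=> FF muK muT FK Fcvg.
have a0 : 0 <= a by rewrite -lee_fin -muT.
have fin nu : nu setT = a%:E -> defect P K nu \is a fin_num by exact: defect_fin_num.
rewrite -(fineK (fin mu muT)); apply/fine_cvgP; split.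
  by apply: filterS FK => nu [_ nuT]; exact: fin.
apply/cvgrPdist_le => eps eps0.
have [e e0 he] := defect_close eps0 a0.
have near1 := pot_cvg_uniform FF cK (continuous_kernel_trunc e0 cre)
  (fun w => kernel_trunc_le w e0 cre) muK muT FK Fcvg e0.
have near2 := pot_cvg_uniform FF cK (continuous_kernel_trunc e0 cim)
  (fun w => kernel_trunc_le w e0 cim) muK muT FK Fcvg e0.
near=> nu.
have [nuK nuT] : nu (~` K) = 0%E /\ nu setT = a%:E by near: nu.
have h1 : forall z, K z -> `|pot mu (kernel_trunc pre e) z - pot nu (kernel_trunc pre e) z| <= e.
  by near: nu; exact: near1.
have h2 : forall z, K z -> `|pot mu (kernel_trunc pim e) z - pot nu (kernel_trunc pim e) z| <= e.
  by near: nu; exact: near2.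
have h1' z : K z -> `|pot nu (kernel_trunc pre e) z - pot mu (kernel_trunc pre e) z| <= e.
  by rewrite distrC; exact: h1.
have h2' z : K z -> `|pot nu (kernel_trunc pim e) z - pot mu (kernel_trunc pim e) z| <= e.
  by rewrite distrC; exact: h2.
have u1 := fine_leD (fin _ nuT) (fin _ muT) (he mu nu muT nuT h1 h2).
have u2 := fine_leD (fin _ muT) (fin _ nuT) (he nu mu nuT muT h1' h2').
exact: distr_le_intro u1 u2.
Unshelve. all: end_near. Qed.

End DefectEstimates.

(** * Weak limits of measures along ultrafilters *)

Section DyadicCodes.
Variables (R : realType) (L : R).
Hypothesis L0 : 0 < L.
Implicit Types (x y : R) (z : R * R) (n j : nat).

(** For [|x| < L], this is the fractional part of [2^n (x + L) / (2 L)], and [bit n x] is the next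
    binary digit of the rescaled coordinate. *)
Fixpoint residue n x : R :=
  if n is m.+1 then 2 * residue m x - (2^-1 <= residue m x)%R%:R
  else (x + L) / (2 * L).

Definition bit n x : bool := 2^-1 <= residue n x.

(** Each digit in base 4 joins one binary digit of each coordinate: [code n z] numbers the [4^n]
    cells of a dyadic grid, and division by 4 passes to the parent cell. *)
Fixpoint code n z : nat :=
  if n is m.+1 then (4 * code m z + (2 * bit m z.1 + bit m z.2))%N else 0%N.

Let digit_lt4 n z : (2 * bit n z.1 + bit n z.2 < 4)%N.
Proof. by case: (bit n z.1); case: (bit n z.2). Qed.

Lemma code_div n z : (code n.+1 z %/ 4)%N = code n z.
Proof. by rewrite /= mulnC divnMDl// divn_small ?addn0. Qed.

Lemma code_lt n z : (code n z < 4 ^ n)%N.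
Proof. by elim: n => [//|n IH]; rewrite expnSr -ltn_divLR// code_div. Qed.

Lemma residue_itv n x : `|x| < L -> 0 <= residue n x < 1.
Proof.
rewrite ltr_norml => /andP[Lx xL]; elim: n => [|n /andP[r0 r1]] /=.
  apply/andP; split; first by apply: divr_ge0; lra.
  by rewrite ltr_pdivrMr ?mulr_gt0//; lra.
by case: (leP 2^-1 (residue n x)) => h /=; apply/andP; split; lra.
Qed.

Lemma code_eq_bits n z z' : code n.+1 z = code n.+1 z' ->
  [/\ code n z = code n z', bit n z.1 = bit n z'.1 & bit n z.2 = bit n z'.2].
Proof.
move=> h; have cn : code n z = code n z' by rewrite -(code_div n z) h code_div.
move: h => /=; rewrite cn => /addnI.
by case: (bit n z.1); case: (bit n z.2); case: (bit n z'.1); case: (bit n z'.2).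
Qed.

(** Equal codes mean that the same digits have been subtracted, so that the difference of residues
    has only been doubled at each stage. Residues in [[0, 1[] then force the points to be close. *)
Lemma code_eq_residue n z z' : code n z = code n z' ->
  residue n z.1 - residue n z'.1 = 2 ^+ n * ((z.1 - z'.1) / (2 * L)) /\
  residue n z.2 - residue n z'.2 = 2 ^+ n * ((z.2 - z'.2) / (2 * L)).
Proof.
elim: n => [_|n IH /code_eq_bits[/IH[h1 h2] b1 b2]].
  by rewrite /= !mul1r -!mulrBl; split; congr (_ / _); ring.
rewrite /= -/(bit n z.1) -/(bit n z'.1) -/(bit n z.2) -/(bit n z'.2) b1 b2 !exprS.
by rewrite -!(mulrA 2) -h1 -h2; split; ring.
Qed.

Lemma code_eq_close n z z' : `|z| < L -> `|z'| < L -> code n z = code n z' ->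
  `|z - z'| <= 2 * L * 2^-1 ^+ n.
Proof.
move=> zL z'L /code_eq_residue[h1 h2].
have close x y : `|x| < L -> `|y| < L ->
    residue n x - residue n y = 2 ^+ n * ((x - y) / (2 * L)) ->
    `|x - y| <= 2 * L * 2^-1 ^+ n.
  move=> /(residue_itv n)/andP[x0 x1] /(residue_itv n)/andP[y0 y1] h.
  have -> : x - y = 2 * L * 2^-1 ^+ n * (residue n x - residue n y).
    rewrite h exprVn; field.
    by rewrite gt_eqF//= expf_neq0.
  rewrite normrM (@ger0_norm _ (2 * L * _)) ?mulr_ge0 ?exprn_ge0 ?(ltW L0)//.
  rewrite ler_piMr ?mulr_ge0 ?exprn_ge0 ?(ltW L0)// ler_norml.
  by apply/andP; split; lra.
have comp z0 : `|z0| < L -> `|z0.1| < L /\ `|z0.2| < L.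
  by rewrite normP_max gt_max => /andP[].
have [[a1 a2] [b1 b2]] := (comp _ zL, comp _ z'L).
by rewrite normP_max ge_max /= !close.
Qed.

Lemma measurable_residue n : measurable_fun setT (residue n : measurableTypeR R -> R).
Proof.
elim: n => [|n IH] /=.
  by apply: measurable_funM => //; apply: measurable_funD.
apply: measurable_funB; first exact: measurable_funM.
apply: (@measurableT_comp _ _ _ _ _ _ (fun b : bool => b%:R : R)) => //.
by apply: measurable_fun_ler.
Qed.

Lemma measurable_code n : measurable_fun setT ((fun z => (code n z)%:R) : plane R -> R).
Proof.
have mbit m : measurable_fun setT ((fun x => (bit m x)%:R) : measurableTypeR R -> R).
  apply: (@measurableT_comp _ _ _ _ _ _ (fun b : bool => b%:R : R)) => //.
  by apply: measurable_fun_ler => //; exact: measurable_residue.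
elim: n => [|n IH]; first exact: measurable_cst.
rewrite (_ : (fun z => _) = fun z => 4 * (code n z)%:R +
    (2 * (bit n z.1)%:R + (bit n z.2)%:R)).
  apply: measurable_funD; first exact: measurable_funM.
  apply: measurable_funD; first apply: measurable_funM => //.
    by apply: (measurableT_comp (mbit n)); exact: measurable_fst.
  by apply: (measurableT_comp (mbit n)); exact: measurable_snd.
by apply/funext => z; rewrite -!natrM -!natrD.
Qed.

Lemma measurable_code_eq n j : measurable ([set z | code n z = j] : set (plane R)).
Proof.
have := measurable_code n measurableT (measurable_set1 j%:R).
rewrite setTI; congr measurable; apply/seteqP; split => z /=; last by move=> ->.
by move=> /eqP; rewrite eqr_nat => /eqP.
Qed.

Lemma measurable_code_lt n j : measurable ([set z | (code n z < j)%N] : set (plane R)).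
Proof.
have := measurable_code n measurableT (measurable_itv `]-oo, j%:R[).
rewrite setTI; congr measurable; apply/seteqP; split => z /=;
  by rewrite in_itv /= ltr_nat.
Qed.

End DyadicCodes.

Lemma fmap_ultra (T T' : Type) (f : T -> T') (U : set_system T) :
  UltraFilter U -> UltraFilter (f @ U).
Proof.
move=> UU; split=> [|G GF UG]; first exact: fmap_proper_filter.
apply/seteqP; split => // A GA.
have [//|UnA] := in_ultra_setVsetC (f @^-1` A) UU.
have GnA : G (~` A) by exact: UG.
by have := filter_ex (filterI GA GnA) => -[t []].
Qed.

Lemma ultra_lim_segment (R : realType) (T : Type) (U : set_system T) (f : T -> R)
    (x y : R) : UltraFilter U -> U [set t | x <= f t <= y] ->
  exists2 l, x <= l <= y & f @ U --> l.
Proof.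
move=> UU Uf; have Uf' : U (f @^-1` `[x, y]%classic).
  by apply: filterS Uf => t /=; rewrite in_itv.
have := @segment_compact R x y; rewrite compact_ultra.
move=> /(_ (f @ U) (fmap_ultra f UU)) [|l [lxy fl]].
  exact: Uf'.
by exists l => //; move: lxy; rewrite /= in_itv /=.
Qed.

Lemma ultra_lim_le (R : realType) (T : Type) (U : set_system T) (f g : T -> R) x y :
  ProperFilter U -> f @ U --> x -> g @ U --> y -> U [set t | f t <= g t] -> x <= y.
Proof.
move=> UU fx gy fg; rewrite leNgt; apply/negP => yx.
have e0 : 0 < (x - y) / 2 by rewrite divr_gt0// subr_gt0.
have /cvgrPdist_lt/(_ _ e0) h1 := fx; have /cvgrPdist_lt/(_ _ e0) h2 := gy.
have [t [[/= h3 h4] h5]] := filter_ex (filterI (filterI h1 h2) fg).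
by move: h3 h4 h5; rewrite !ltr_distl /= => /andP[? ?] /andP[? ?]; lra.
Qed.

Section QuantileFunction.
Variables (R : realType) (a : R) (F : nat -> nat -> R).
Hypotheses (F0 : forall n, F n 0%N = 0) (Fa : forall n, F n (4 ^ n)%N = a)
  (Fmono : forall n, {homo F n : i j / (i <= j)%N >-> i <= j})
  (Fdiv : forall n j, F n.+1 (4 * j)%N = F n j).

(** [F n j] is to be read as the mass of the first [j] cells of the [n]-th grid. The intervals [[F n
    j, F n j.+1[] tile [[0, a[]; a cell of mass 0 gets an empty interval and is never selected. *)
Definition cell n t : set nat := [set j | F n j <= t < F n j.+1].

Lemma cell_unique n t i j : cell n t i -> cell n t j -> i = j.
Proof.
have lt i' j' : cell n t i' -> cell n t j' -> ~~ (i' < j')%N.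
  move=> /andP[_ ti] /andP[jt _]; apply/negP => ij.
  by have := lt_le_trans ti (le_trans (Fmono n ij) jt); rewrite ltxx.
by move=> ci cj; apply/eqP; rewrite eqn_leq leqNgt lt//= leqNgt lt.
Qed.

Definition quantile n t : nat := xget 0%N (cell n t).

Lemma quantileP n t : 0 <= t < a -> cell n t (quantile n t).
Proof.
move=> /andP[t0 ta]; have ex : exists j, t < F n j by exists (4 ^ n)%N; rewrite Fa.
suff : exists j, cell n t j by move=> [j cj]; rewrite /quantile; case: xgetP => // /(_ j).
case: (ex_minnP ex) => -[|j] tj minj; first by rewrite F0 ltNge t0 in tj.
exists j; apply/andP; split => //; rewrite leNgt; apply/negP => /minj.
by rewrite ltnn.
Qed.

Lemma quantile_lt n t : 0 <= t < a -> (quantile n t < 4 ^ n)%N.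
Proof.
move=> ta; have /andP[qt _] := quantileP n ta; rewrite ltnNge; apply/negP => h.
by move: ta => /andP[_]; rewrite ltNge (le_trans _ qt)// -(Fa n) Fmono.
Qed.

(** By [Fdiv], the intervals of the four children of a cell fill the interval of that cell; hence
    the cells selected for a given [t] are nested. *)
Lemma quantile_div n t : 0 <= t < a -> (quantile n.+1 t %/ 4)%N = quantile n t.
Proof.
move=> ta; apply: (@cell_unique n t _ _ _ (quantileP n ta)).
have /andP[h1 h2] := quantileP n.+1 ta; set q := quantile n.+1 t in h1 h2 *.
apply/andP; split.
  by apply: le_trans h1; rewrite -(Fdiv n) Fmono// mulnC leq_trunc_div.
apply: lt_le_trans h2 _; rewrite -(Fdiv n) Fmono//.
by rewrite mulnC -ltn_divLR.
Qed.

End QuantileFunction.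

Lemma div_chain (u v : nat -> nat) :
  (forall n, (u n.+1 %/ 4)%N = u n) -> (forall n, (v n.+1 %/ 4)%N = v n) ->
  forall m n, (n <= m)%N -> u m = v m -> u n = v n.
Proof.
move=> hu hv m n /subnK <-; elim: (m - n)%N => [//|k IH] h.
by apply: IH; rewrite -hu -hv; congr (_ %/ _)%N.
Qed.

(* Both the approximants (label = cell of the point) and the limit measure, seen
   on the interval [0, a[ through the quantile function, are compared with the
   same finite sum over cells. *)
Lemma integral_cell_sum (R : realType) d (T : measurableType d)
    (m : {measure set T -> \bar R}) (D : set T) (Y : T -> R * R) (l : T -> nat)
    (pt : nat -> R * R) (N : nat) (g : R * R -> R) (w : R) :
  measurable D -> (m D < +oo)%E ->
  (forall j, measurable (D `&` [set t | l t = j])) ->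
  (forall t, D t -> (l t < N)%N) ->
  measurable_fun D (g \o Y) ->
  (forall t, D t -> `|g (Y t) - g (pt (l t))| <= w) ->
  `|Rintegral m D (g \o Y) -
    \sum_(j < N) g (pt j) * fine (m (D `&` [set t | l t = j]))| <= w * fine (m D).
Proof.
move=> mD mDoo ml lN mgY hw.
pose E j := D `&` [set t | l t = j].
pose h t := \sum_(j < N) g (pt j) * \1_(E j) t.
have hE t : D t -> h t = g (pt (l t)).
  move=> Dt; rewrite /h (bigD1 (Ordinal (lN t Dt)))//= indicE mem_set ?mulr1; last by split.
  rewrite big1 ?addr0// => j jl; rewrite indicE memNset ?mulr0// => -[_ /= lj].
  by move/eqP: jl; apply; apply/val_inj; rewrite /= lj.
have iE j : m.-integrable D (EFin \o (fun t => g (pt j) * \1_(E j) t)).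
  have : m.-integrable D (EFin \o \1_(E j)).
    apply: measurable_bounded_integrable => //.
      by apply: measurable_indic; exact: ml.
    exists 1; split; first exact: num_real.
    move=> x x1 t _ /=; apply: le_trans (ltW x1); rewrite indicE.
    by case: (_ \in _); rewrite ?normr1 ?normr0.
  by move=> /(integrableZl mD (g (pt j))); apply: eq_integrable.
have ih : m.-integrable D (EFin \o h).
  apply: (eq_integrable mD (fun t => \sum_(j < N) (g (pt j) * \1_(E j) t)%:E)%E).
    by move=> t _; rewrite /h /= sumEFin.
  by apply: integrable_sum => // j _; exact: iE.
have mh : measurable_fun D h by apply/measurable_EFinP; exact: (measurable_int _ ih).
pose gh t := g (Y t) - h t.
have id : m.-integrable D (EFin \o gh).
  apply: measurable_bounded_integrable => //; first exact: measurable_funB.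
  exists w; split; first exact: num_real.
  by move=> x wx t Dt /=; rewrite /gh hE//; apply: le_trans (hw t Dt) (ltW wx).
have igY : m.-integrable D (EFin \o (g \o Y)).
  apply: (eq_integrable mD ((EFin \o gh) \+ (EFin \o h))%E).
    by move=> t _; rewrite /= -EFinD /gh subrK.
  exact: integrableD.
have -> : \sum_(j < N) g (pt j) * fine (m (E j)) = Rintegral m D h.
  have -> : Rintegral m D h =
      fine (\sum_(j < N) \int[m]_(t in D) (g (pt j) * \1_(E j) t)%:E)%E.
    rewrite -(integral_sum mD (fun j : 'I_N => iE j)); congr fine.
    by apply: eq_integral => t _; rewrite /h sumEFin.
  rewrite -sum_fine; last by move=> j _; exact: integrable_fin_num (iE j).
  apply: eq_bigr => j _.
  rewrite -[RHS]/(Rintegral m D _) RintegralZl//; last first.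
    apply: measurable_bounded_integrable => //.
      by apply: measurable_indic; exact: ml.
    exists 1; split; first exact: num_real.
    move=> x x1 t _ /=; apply: le_trans (ltW x1); rewrite indicE.
    by case: (_ \in _); rewrite ?normr1 ?normr0.
  congr (_ * fine _); rewrite integral_indic//; last exact: ml.
  by rewrite /E setIAC setIid.
rewrite -RintegralB//; apply: le_trans (le_normr_Rintegral _ id) _ => //.
rewrite -Rintegral_cst//; apply: le_Rintegral => //.
- exact: integrable_norm.
- by apply: measurable_bounded_integrable => //; exact: bounded_cst.
- by move=> t Dt; rewrite /gh hE//; exact: hw.
Qed.

Lemma compact_uniform_continuity (R : realType) (K : set (R * R)) (g : R * R -> R)
    (e : R) : compact K -> continuous g -> 0 < e ->
  exists2 del, 0 < del & forall z z', K z -> `|z - z'| < del -> `|g z - g z'| <= e.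
Proof.
move=> /compact_near_coveringP cover cg e0.
have := cover _ (0:R)^'+ (fun del z => forall z', `|z - z'| < del -> `|g z - g z'| <= e) _.
case.
  move=> z Kz; have e20 : 0 < e / 2 by rewrite divr_gt0.
  have /cvgrPdist_lt/(_ _ e20)/nbhs_ballP[rho /= rho0 hrho] := cg z.
  have rho20 : 0 < rho / 2 by rewrite divr_gt0.
  exists (ball z (rho / 2), [set d | d < rho / 2]).
    by split; [exact: nbhsx_ballx|exact: nbhs_right_lt].
  move=> [w d] /= [zw dr] z' wz'.
  have zw' : `|z - w| < rho / 2 by move: zw; rewrite -ball_normE.
  have h1 : `|g z - g w| < e / 2.
    by apply: hrho; rewrite -ball_normE /=; apply: lt_trans zw' _; lra.
  have h2 : `|g z - g z'| < e / 2.
    apply: hrho; rewrite -ball_normE /=; have := ler_distD w z z'.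
    by move: zw' wz' dr; set A := `|z - w|; set B := `|w - z'|; set C' := `|z - z'|; lra.
  have := ler_distD (g z) (g w) (g z'); rewrite (distrC (g w) (g z)); lra.
move=> d /= d0 hd; exists (d / 2); first by rewrite divr_gt0.
move=> z z' Kz zz'; apply: (hd (d / 2)) => //=.
- by rewrite sub0r normrN gtr0_norm ?divr_gt0// ltr_pdivrMr// ltr_pMr// ltr1n.
- by rewrite divr_gt0.
Qed.

Lemma pushforward_measureP (R : realType) (X : measurableTypeR R -> plane R) :
  measurable_fun setT X -> exists m : {measure set (plane R) -> \bar R},
    m = pushforward (@lebesgue_measure R) X :> (set (plane R) -> \bar R).
Proof.
move=> mX; pose leb : {measure set (measurableTypeR R) -> \bar R} := @lebesgue_measure R.
by unshelve eexists (pushforward leb X); first exact: mX.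
Qed.

(** The map is defined on a line of infinite length; restricting the image to [K] retains only the
    part coming from the preimage of [K], which is [[0, a[] in the application. *)
Lemma restricted_image_measure (R : realType) (X : measurableTypeR R -> plane R)
    (K : set (plane R)) : measurable_fun setT X -> measurable K ->
  (lebesgue_measure (X @^-1` K) < +oo)%E ->
  exists mu : plane_measure R, forall A, measurable A ->
    mu A = lebesgue_measure (X @^-1` (A `&` K)).
Proof.
move=> mX mK fin.
have [push pushE] := pushforward_measureP mX.
have finr : fin_num_fun (mrestr push mK).
  move=> A mA; rewrite ge0_fin_numE//; apply: le_lt_trans fin.
  rewrite /mrestr pushE /pushforward; apply: le_measure; rewrite ?inE.
  - by rewrite -[X in measurable X]setTI; apply: mX => //; exact: measurableI.
  - by rewrite -[X in measurable X]setTI; apply: mX.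
  - by move=> t [].
pose mu : plane_measure R := HB.pack (mrestr push mK)
  (Measure_isFinite.Build _ _ _ (mrestr push mK) finr).
by exists mu => A mA; rewrite /= /mrestr pushE.
Qed.

(** * Construction of the weak limit by quantiles *)

Section WeakLimit.
Variables (R : realType) (K : set (R * R)) (p : R * R) (c : nat -> R * R -> nat) (r : nat -> R).
Hypotheses (cK : compact K) (Kp : ~ K p)
  (c_div : forall n z, (c n.+1 z %/ 4)%N = c n z)
  (c_lt : forall n z, (c n z < 4 ^ n)%N)
  (mc_eq : forall n j, measurable ([set z | c n z = j] : set (plane R)))
  (mc_lt : forall n j, measurable ([set z | (c n z < j)%N] : set (plane R)))
  (c_close : forall n z z', K z -> K z' -> c n z = c n z' -> `|z - z'| <= r n)
  (r0 : r @ \oo --> 0).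
Variables (a : R) (U : set_system (plane_measure R)).
Hypotheses (a0 : 0 <= a) (UU : UltraFilter U)
  (UK : U [set nu : plane_measure R | nu (~` K) = 0%E /\ nu setT = a%:E]).
Implicit Types (n j : nat) (nu : plane_measure R) (t : R).

Let mK : measurable (K : set (plane R)) := compact_measurable_plane cK.

(** The cumulative mass of the cells of code less than [j]; [F] below is its limit along [U], which
    exists because the values stay in [[0, a]]. *)
Let G n j nu : R := fine (nu [set z | (c n z < j)%N]).

Let G_mono nu n i j : (i <= j)%N -> G n i nu <= G n j nu.
Proof.
move=> ij; apply: fine_le; rewrite ?fin_num_measure//.
by apply: le_measure; rewrite ?inE// => z /= zi; exact: leq_trans zi ij.
Qed.

Let G_itv n j : U [set nu | 0 <= G n j nu <= a].
Proof.
apply: filterS UK => nu [_ nuT]; apply/andP; split; first exact: fine_ge0.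
rewrite -[a]/(fine a%:E) -nuT; apply: fine_le; rewrite ?fin_num_measure//.
by apply: le_measure; rewrite ?inE.
Qed.

Let F n j : R := projT1 (cid2 (ultra_lim_segment UU (G_itv n j))).

Let F_cvg n j : G n j @ U --> F n j.
Proof. by rewrite /F; case: cid2. Qed.

Let F_le n i m j : U [set nu | G n i nu <= G m j nu] -> F n i <= F m j.
Proof. exact: (ultra_lim_le (@ultra_proper _ _ UU) (@F_cvg n i) (@F_cvg m j)). Qed.

Let F_lim n j (x : R) : U [set nu | G n j nu = x] -> F n j = x.
Proof.
move=> h; have cx : (fun=> x : R) @ U --> x by exact: cvg_cst.
apply/eqP; rewrite eq_le; apply/andP; split.
- by apply: (ultra_lim_le (@ultra_proper _ _ UU) (@F_cvg n j) cx); apply: filterS h => nu /= ->.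
- by apply: (ultra_lim_le (@ultra_proper _ _ UU) cx (@F_cvg n j)); apply: filterS h => nu /= ->.
Qed.

Let F0 n : F n 0%N = 0.
Proof.
apply: F_lim; apply: filterS UK => nu _ /=; rewrite /G.
by rewrite (_ : [set z | _] = set0) ?measure0//; apply/seteqP; split.
Qed.

Let Fa n : F n (4 ^ n)%N = a.
Proof.
apply: F_lim; apply: filterS UK => nu [_ nuT] /=; rewrite /G.
rewrite (_ : [set z | _] = setT) ?nuT//; apply/seteqP; split => // z _ /=.
exact: c_lt.
Qed.

Let Fmono n : {homo F n : i j / (i <= j)%N >-> i <= j}.
Proof. by move=> i j ij; apply: F_le; apply: filterS UK => nu _; exact: G_mono. Qed.

Let Fdiv n j : F n.+1 (4 * j)%N = F n j.
Proof.
have GE nu : G n.+1 (4 * j)%N nu = G n j nu.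
  rewrite /G; congr (fine (nu _)); apply/seteqP; split => z /=;
    by rewrite mulnC -ltn_divLR// c_div.
by apply/eqP; rewrite eq_le; apply/andP; split; apply: F_le; apply: filterS UK => nu _ /=;
  rewrite GE.
Qed.

Let G_cell n j nu : nu (~` K) = 0%E ->
  fine (nu (K `&` [set z | c n z = j])) = G n j.+1 nu - G n j nu.
Proof.
move=> nuK; rewrite /G.
have -> : nu [set z | (c n z < j.+1)%N] =
    (nu [set z | (c n z < j)%N] + nu [set z | c n z = j])%E.
  rewrite -measureU//; last first.
    by apply/seteqP; split => // z [/= h1 h2]; rewrite h2 ltnn in h1.
  congr (nu _); apply/seteqP; split => z /=.
    by rewrite ltnS leq_eqVlt => /orP[/eqP|]; [right|left].
  by move=> [/ltnW|->]; rewrite ltnS.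
rewrite fineD ?fin_num_measure// addrC addKr; congr fine.
have -> : nu [set z | c n z = j] =
    (nu (K `&` [set z | c n z = j]) + nu (~` K `&` [set z | c n z = j]))%E.
  rewrite -measureU//; first by rewrite -setIUl setUv setTI.
  - by apply: measurableI.
  - by apply: measurableI => //; exact: measurableC.
  - by rewrite setIACA setICr set0I.
rewrite [X in (_ + X)%E](_ : _ = 0%E) ?adde0//.
apply: (@subset_measure0 _ _ _ nu _ (~` K)) => //.
- by apply: measurableI => //; exact: measurableC.
- exact: measurableC.
Qed.

Let pt n j : R * R := xget p [set z | K z /\ c n z = j].

(** A cell that misses [K] has mass 0 for every measure carried by [K], and so keeps mass 0 in the
    limit; a selected cell therefore has a representative in [K]. *)
Let ptP n j : F n j < F n j.+1 -> K (pt n j) /\ c n (pt n j) = j.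
Proof.
move=> Fj; rewrite /pt; case: xgetP => [z -> //|noz]; exfalso.
suff : F n j.+1 <= F n j by rewrite leNgt Fj.
apply: F_le; apply: filterS UK => nu [nuK _] /=.
rewrite -subr_le0 -(G_cell _ _ nuK) (_ : _ `&` _ = set0) ?measure0//.
by apply/seteqP; split => // z [Kz cz]; case: (noz z).
Qed.

Let D : set (measurableTypeR R) := `[0, a[%classic.
Let q n t := quantile F n t.
Let x n t := pt n (q n t).

Let DP t : D t -> 0 <= t < a.
Proof. by rewrite /D /= in_itv. Qed.

Let qcell n t : D t -> cell F n t (q n t).
Proof. by move=> /DP; exact: quantileP. Qed.

Let xP n t : D t -> K (x n t) /\ c n (x n t) = q n t.
Proof.
by move=> /(qcell n)/andP[h1 h2]; apply: ptP; exact: le_lt_trans h1 h2.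
Qed.

Let x_close n m t : D t -> (n <= m)%N -> `|x m t - x n t| <= r n.
Proof.
move=> Dt nm; have [Km cm] := xP m Dt; have [Kn cn] := xP n Dt.
apply: c_close => //; rewrite cn.
apply: (@div_chain (fun k => c k (x m t)) (fun k => q k t) _ _ m) => // k.
by apply: quantile_div => //; exact: DP.
Qed.

(** The value [p], outside of [K], marks the parameters outside of [[0, a[], so that the preimage of
    [K] is exactly this interval. *)
Let X t : R * R := xget p [set y | D t /\ K y /\ forall n, `|y - x n t| <= r n].

Let XP t : D t -> K (X t) /\ forall n, `|X t - x n t| <= r n.
Proof.
move=> Dt; suff [y [Ky hy]] : exists y, K y /\ forall n, `|y - x n t| <= r n.
  by rewrite /X; case: xgetP => [z -> []//|/(_ y)]; case.
have xK : ((fun n => x n t) @ \oo) K.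
  by exists 0%N => // n _; have [] := xP n Dt.
(* A cluster point in [K] is enough: the points [x m t] with [m >= n] stay within [r n] of [x n t],
   and this closed condition passes to [y]. *)
have [y [Ky cy]] := cK _ xK; exists y; split => // n.
apply/ler_addgt0Pr => e e0.
have nx : ((fun n => x n t) @ \oo) [set z | `|z - x n t| <= r n].
  by exists n => // m /= nm; exact: x_close.
have [z [/= zn]] := cy _ _ nx (nbhsx_ballx y e e0).
rewrite -ball_normE /= => yz; apply: le_trans (ler_distD z _ _) _.
by rewrite addrC lerD// ltW.
Qed.

Let XnD t : ~ D t -> X t = p.
Proof. by move=> nD; rewrite /X; case: xgetP => // y _ []. Qed.

Let X_preim : X @^-1` K = D.
Proof.
apply/seteqP; split => t; last by move=> /XP[].
by move=> /= KX; apply: contrapT => /XnD XE; rewrite XE in KX.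
Qed.

Let D_cell n j : (j < 4 ^ n)%N -> D `&` [set t | q n t = j] = `[F n j, F n j.+1[%classic.
Proof.
move=> jn; apply/seteqP; split => t /=.
  by move=> [Dt <-]; rewrite in_itv /=; exact: qcell.
rewrite in_itv /= => ct; have Dt : D t.
  rewrite /D /= in_itv /=; case/andP: ct => h1 h2.
  rewrite -(F0 n) (le_trans (Fmono n (leq0n j)) h1) /=.
  by apply: lt_le_trans h2 _; rewrite -(Fa n) Fmono.
by split => //; exact: (cell_unique Fmono (qcell n Dt)).
Qed.

(** On [D], the coordinate is a pointwise limit of step functions, constant on each [[F n j, F n
    j.+1[]; off [D], [X] is constant. *)
Let mX1 (pr : R * R -> R) : (forall z, `|pr z| <= `|z|) -> {morph pr : y z / y - z} ->
  measurable_fun setT (fun t : measurableTypeR R => pr (X t)).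
Proof.
move=> pr1 prB; have mD : measurable D by exact: measurable_itv.
rewrite -(setUv D) measurable_funU//; last exact: measurableC.
split; last first.
  by apply: (@eq_measurable_fun _ _ _ _ _ (cst (pr p))) => // t; rewrite inE => /XnD ->.
apply: (@measurable_fun_cvg _ _ _ _ (fun n t => pr (x n t))); last first.
  move=> t Dt; apply/cvgrPdist_le => e e0.
  have /cvgrPdist_le/(_ e e0) := r0; apply: filterS => n rn.
  rewrite -prB; apply: le_trans (pr1 _) _; have [_ /(_ n) Xn] := XP Dt; apply: le_trans Xn _.
  by apply: le_trans rn; rewrite sub0r normrN ler_norm.
move=> n.
apply: (@eq_measurable_fun _ _ _ _ _
  (fun t => \sum_(j < 4 ^ n) pr (pt n j) *
    \1_(`[F n j, F n j.+1[%classic : set (measurableTypeR R)) t)).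
  move=> t; rewrite inE => Dt; have qt := quantile_lt F0 Fa Fmono n (DP Dt).
  rewrite (bigD1 (Ordinal qt))//= big1 ?addr0.
    by rewrite -(D_cell qt) indicE mem_set ?mulr1//; split.
  move=> j jq; rewrite -D_cell// indicE memNset ?mulr0// => -[_ /= qj].
  by move/eqP: jq; apply; apply/val_inj.
by apply: measurable_sum => j; apply: measurable_funM.
Qed.

Let mX : measurable_fun setT (X : measurableTypeR R -> plane R).
Proof.
apply/measurable_fun_pairP; split.
- apply: (mX1 (pr := fun z : R * R => z.1)) => // z.
  by rewrite normP_max le_max lexx.
- apply: (mX1 (pr := fun z : R * R => z.2)) => // z.
  by rewrite normP_max le_max lexx orbT.
Qed.

Let leb : {measure set (measurableTypeR R) -> \bar R} := @lebesgue_measure R.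

Let lebD : leb D = a%:E.
Proof.
rewrite /leb /D /= lebesgue_measure_itv /= lte_fin; case: ltP => [_|a_le0]; first by rewrite sube0.
by congr EFin; apply/eqP; rewrite eq_le a0 a_le0.
Qed.

Let leb_cell n j : (j < 4 ^ n)%N ->
  fine (leb (D `&` [set t | q n t = j])) = F n j.+1 - F n j.
Proof.
move=> jn; rewrite D_cell// /leb /= lebesgue_measure_itv /= lte_fin.
have : F n j <= F n j.+1 by exact: Fmono.
by rewrite le_eqVlt => /predU1P[->|->]; rewrite ?ltxx ?subrr.
Qed.

(** A Riemann sum on the [n]-th grid, as a function of the cumulative masses: with [G] it
    approximates the integral against [nu], with [F] that against the limit. Only finitely many
    values of [H] enter, so it passes to the limit along [U]. *)
Let cells n (H : nat -> R) (g : R * R -> R) : R :=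
  \sum_(j < 4 ^ n) g (pt n j) * (H j.+1 - H j).

Let approx_nu n nu (g : R * R -> R) (w : R) : continuous g -> nu (~` K) = 0%E -> nu setT = a%:E ->
  (forall z z', K z -> K z' -> `|z - z'| <= r n -> `|g z - g z'| <= w) ->
  `|Rintegral nu setT g - cells n (fun j => G n j nu) g| <= w * a.
Proof.
move=> cg nuK nuT gw.
have ig := integrable_continuous cK nuK cg.
have nuKa : fine (nu K) = a.
  have : nu setT = (nu (~` K) + nu K)%E.
    by rewrite -measureU ?setvU//; [exact: measurableC|exact: setICl].
  by rewrite nuK add0e nuT => <-.
rewrite (Rintegral_on mK nuK ig) -[X in _ * X]nuKa.
rewrite (_ : cells _ _ _ = \sum_(j < 4 ^ n) g (pt n j) *
    fine (nu (K `&` [set z | c n z = j]))); last first.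
  by apply: eq_bigr => j _; rewrite G_cell.
apply: (@integral_cell_sum R _ (plane R) nu K id (c n) (pt n) (4 ^ n)%N g w) => //.
- by rewrite -ge0_fin_numE// fin_num_measure.
- by move=> j; exact: measurableI.
- by apply: measurable_funTS; exact: continuous_measurable_plane.
move=> z Kz; have [Kp' cp'] : K (pt n (c n z)) /\ c n (pt n (c n z)) = c n z.
  by rewrite /pt; case: xgetP => // /(_ z); case.
by apply: gw => //; apply: c_close.
Qed.

Let approx_limit n (mu : plane_measure R) (g : R * R -> R) (w : R) :
  continuous g -> mu (~` K) = 0%E ->
  (forall A, measurable A -> mu A = leb (X @^-1` (A `&` K))) ->
  (forall z z', K z -> K z' -> `|z - z'| <= r n -> `|g z - g z'| <= w) ->
  `|Rintegral mu setT g - cells n (F n) g| <= w * a.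
Proof.
move=> cg muK muE gw.
have ig := integrable_continuous cK muK cg.
have mg : measurable_fun setT (g : plane R -> R) by exact: continuous_measurable_plane.
have mD : measurable D by exact: measurable_itv.
have [M hM] : exists M, forall z, K z -> `|g z| <= M.
  have /compact_bounded[M [_ hM]] := continuous_compact (continuous_subspaceT cg) cK.
  by exists (M + 1) => z Kz; apply: (hM (M + 1)); rewrite ?ltrDl//; exists z.
have mgX : measurable_fun D (g \o X).
  by apply: measurable_funTS; exact: (measurableT_comp mg mX).
have igX : leb.-integrable D (EFin \o (g \o X)).
  apply: measurable_bounded_integrable => //; first by rewrite lebD ltry.
  exists M; split; first exact: num_real.
  by move=> y My t Dt /=; apply: le_trans (ltW My); apply: hM; have [] := XP Dt.
have -> : Rintegral mu setT g = Rintegral leb D (g \o X).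
  rewrite (Rintegral_on mK muK ig) /Rintegral; congr fine.
  have [push pushE] := pushforward_measureP mX.
  rewrite (eq_measure_integral push); last first.
    move=> A mA AK; apply: (etrans (muE A mA)).
    by rewrite pushE /pushforward setIidl.
  rewrite pushE (integral_pushforward mX) ?X_preim//; exact/measurable_EFinP.
rewrite (_ : cells _ _ _ = \sum_(j < 4 ^ n) g (pt n j) *
    fine (leb (D `&` [set t | q n t = j]))); last first.
  by apply: eq_bigr => j _; rewrite leb_cell.
rewrite -[X in _ * X]/(fine a%:E) -lebD.
apply: (@integral_cell_sum R _ _ leb D X (q n) (pt n) (4 ^ n)%N g w) => //.
- by rewrite lebD ltry.
- move=> j; have [jn|nj] := ltnP j (4 ^ n)%N.
    by rewrite D_cell//; exact: measurable_itv.
  rewrite (_ : _ `&` _ = set0)//; apply/seteqP; split => // t [Dt /= qj].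
  by have := quantile_lt F0 Fa Fmono n (DP Dt); rewrite -/(q n t) qj ltnNge nj.
- by move=> t Dt; exact: (quantile_lt F0 Fa Fmono n (DP Dt)).
- by move=> t Dt; have [KX hX] := XP Dt; apply: gw; [|have [] := xP n Dt|exact: hX].
Qed.

Lemma weak_limit_codes : exists mu : plane_measure R,
  [/\ mu (~` K) = 0%E, mu setT = a%:E & forall g, continuous g ->
    (fun nu : plane_measure R => Rintegral nu setT g) @ U --> Rintegral mu setT g].
Proof.
have fin : (lebesgue_measure (X @^-1` K) < +oo)%E by rewrite X_preim [ltLHS]lebD ltry.
have [mu muE] := restricted_image_measure mX mK fin; exists mu.
have muK : mu (~` K) = 0%E.
  by rewrite muE ?setICl ?preimage_set0 ?measure0//; exact: measurableC.
split => //; first by rewrite muE// setTI X_preim [LHS]lebD.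
move=> g cg; apply/cvgrPdist_le => e e0.
pose w := e / (3 * (a + 1)).
have w0 : 0 < w by rewrite divr_gt0// mulr_gt0// ltr_wpDl.
have wa : w * a <= e / 3.
  have a1 : 0 < a + 1 by rewrite ltr_wpDl.
  rewrite (_ : w * a = e / 3 * (a / (a + 1))); last by rewrite /w; field; rewrite gt_eqF.
  by rewrite ler_piMr ?(divr_ge0 (ltW e0))// ler_pdivrMr// mul1r lerDl.
have [del del0 hdel] := compact_uniform_continuity cK cg w0.
(* The grid is fixed before [nu]: the two approximation errors are then at most [e / 3] for all the
   measures at once, and the last third is left for the convergence of the sums. *)
have [n rn] : exists n, r n < del.
  have /cvgrPdist_lt/(_ _ del0)[n _ /(_ n (leqnn n))] := r0.
  by rewrite /= sub0r normrN => h; exists n; apply: le_lt_trans (ler_norm _) h.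
have gw z z' : K z -> K z' -> `|z - z'| <= r n -> `|g z - g z'| <= w.
  by move=> Kz _ zz'; apply: hdel => //; exact: le_lt_trans zz' rn.
have h1 := approx_limit cg muK muE gw.
have cells_cvg : (fun nu => cells n (fun j => G n j nu) g) @ U --> cells n (F n) g.
  apply: cvg_big => [|j _]; first exact: add_continuous.
  apply: cvgMl_tmp; apply: cvgB; exact: F_cvg.
have e30 : 0 < e / 3 by rewrite divr_gt0.
have /cvgrPdist_le/(_ _ e30) h2 := cells_cvg.
apply: filterS (filterI h2 UK) => nu [/= h3 [nuK nuT]].
have h4 := approx_nu cg nuK nuT gw.
move: h1 h3 h4; set A := Rintegral mu _ _; set B := cells n (F n) g.
set B' := cells n _ g; set A' := Rintegral nu _ _ => h1 h3 h4.
have := ler_distD B A A'; have := ler_distD B' B A'.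
by rewrite (distrC B' A'); lra.
Qed.

End WeakLimit.

Lemma measure_weak_limit (R : realType) (K : set (R * R)) (a : R)
    (U : set_system (plane_measure R)) : compact K -> 0 <= a -> UltraFilter U ->
  U [set nu : plane_measure R | nu (~` K) = 0%E /\ nu setT = a%:E] ->
  exists mu : plane_measure R, [/\ mu (~` K) = 0%E, mu setT = a%:E &
    forall g, continuous g ->
      (fun nu : plane_measure R => Rintegral nu setT g) @ U --> Rintegral mu setT g].
Proof.
move=> cK a0 UU UK; have /compact_bounded[M [_ hM]] := cK.
(* [K] lies strictly inside the square of half-side [L], which the residues require; the corner
   [(L, L)] is then a point outside of [K]. *)
pose L := `|M| + 2; have L0 : 0 < L by rewrite ltr_wpDl.
have KL z : K z -> `|z| < L.
  move=> Kz; apply: (@le_lt_trans _ _ (`|M| + 1)); last by rewrite ltrD2l ltr1n.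
  by apply: (hM (`|M| + 1)) => //; rewrite (le_lt_trans (ler_norm M))// ltrDl.
apply: (@weak_limit_codes R K (L, L) (code L) (fun n => 2 * L * 2^-1 ^+ n)) => //.
- by move=> /KL; rewrite normP_max /= maxxx (gtr0_norm L0) ltxx.
- exact: code_div.
- exact: code_lt.
- exact: measurable_code_eq.
- exact: measurable_code_lt.
- by move=> n z z' Kz Kz'; apply: code_eq_close => //; exact: KL.
- rewrite -(mulr0 (2 * L)); apply: cvgMl_tmp; apply: cvg_expr.
  by rewrite ger0_norm// invf_lt1// ltr1n.
Qed.

(** * Propagation of an algebraic equation from a germ *)

Lemma le0_geometric (R : realType) (x C1 C2 t1 t2 : R) :
  0 <= t1 < 1 -> 0 <= t2 < 1 ->
  (forall n : nat, x <= C1 * t1 ^+ n + C2 * t2 ^+ n) -> x <= 0.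
Proof.
move=> /andP[t10 t11] /andP[t20 t21] h.
have : (fun n : nat => C1 * t1 ^+ n + C2 * t2 ^+ n) @ \oo --> C1 * 0 + C2 * 0.
  by apply: cvgD; apply: cvgMl_tmp; apply: cvg_expr; rewrite ger0_norm.
rewrite !mulr0 addr0 => /cvgrPdist_lt cv; apply/ler_addgt0Pr => e e0.
have [n _ /(_ n (leqnn n))] := cv e e0; rewrite /= sub0r normrN add0r => hn.
exact: le_trans (h n) (le_trans (ler_norm _) (ltW hn)).
Qed.

Section Majorants.
Variable R : realType.
Implicit Types (A : {poly R[i]}) (B : {poly R}) (v : R[i]).
Local Notation normc := (@Normc.normc R).

(** Cauchy's majorants: unlike a bound on values, domination of coefficients is stable under
    products and survives the removal of low-order terms. *)
Definition majorized A B := forall k, normc A`_k <= B`_k.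

Lemma majorizedD A1 A2 B1 B2 : majorized A1 B1 -> majorized A2 B2 ->
  majorized (A1 + A2) (B1 + B2).
Proof.
by move=> h1 h2 k; rewrite !coefD; apply: le_trans (ler_normcD _ _) _; exact: lerD.
Qed.

Lemma majorizedM A1 A2 B1 B2 : majorized A1 B1 -> majorized A2 B2 ->
  majorized (A1 * A2) (B1 * B2).
Proof.
move=> h1 h2 k; rewrite !coefM; apply: le_trans (ler_normc_sum _ _ _) _.
by apply: ler_sum => i _; rewrite Normc.normcM ler_pM ?normc_ge0.
Qed.

Lemma majorizedX A B n : majorized A B -> majorized (A ^+ n) (B ^+ n).
Proof.
move=> h; elim: n => [|n IH]; last by rewrite !exprS; exact: majorizedM.
by move=> k; rewrite !expr0 !coef1; case: (k == 0%N); rewrite ?Normc.normc1 ?Normc.normc0.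
Qed.

Lemma majorized_sum n (A : nat -> {poly R[i]}) (B : nat -> {poly R}) :
  (forall i, majorized (A i) (B i)) -> majorized (\sum_(i < n) A i) (\sum_(i < n) B i).
Proof.
move=> h; elim: n => [|n IH]; last by rewrite !big_ord_recr; exact: majorizedD.
by move=> k; rewrite !big_ord0 !coef0 Normc.normc0.
Qed.

Definition majorant A : {poly R} := \poly_(i < size A) normc A`_i.

Lemma majorantP A : majorized A (majorant A).
Proof.
move=> k; rewrite coef_poly; case: ltnP => // kA.
by rewrite nth_default// Normc.normc0.
Qed.

(** A Schwarz lemma: for [k >= n], [|v|^k] is at most [(|v| / s)^n s^k], and the terms of lower
    order are absent. *)
Lemma majorized_vanishing A B v (s : R) n : majorized A B -> 0 < s -> normc v <= s ->
  (forall k, (k < n)%N -> A`_k = 0) -> normc A.[v] <= (normc v / s) ^+ n * B.[s].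
Proof.
move=> AB s0 vs A0; pose N := maxn (size A) (size B).
have v0 := normc_ge0 v.
rewrite (@horner_coef_wide _ N A) ?leq_maxl// (@horner_coef_wide _ N B) ?leq_maxr//.
rewrite mulr_sumr; apply: le_trans (ler_normc_sum _ _ _) _.
apply: ler_sum => i _; rewrite Normc.normcM normcX.
have B0 : 0 <= B`_i by apply: le_trans (AB i); exact: normc_ge0.
have [iin|ni] := ltnP i n.
  by rewrite A0// Normc.normc0 mul0r !mulr_ge0 ?exprn_ge0 ?divr_ge0 ?(ltW s0).
rewrite mulrCA ler_pM ?normc_ge0 ?exprn_ge0 ?AB//.
rewrite -(subnKC ni) !exprD mulrA expr_div_n mulfVK ?expf_neq0 ?gt_eqF//.
by rewrite ler_wpM2l ?exprn_ge0// lerXn2r ?nnegrE ?(ltW s0).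
Qed.

(** The constant term vanishes by letting [v] tend to 0; division by ['X] then lowers the order by
    one. *)
Lemma coef_eq0_bigO A n (C s : R) : 0 < s ->
  (forall v, v != 0 -> normc v < s -> normc A.[v] <= C * normc v ^+ n) ->
  forall k, (k < n)%N -> A`_k = 0.
Proof.
move=> s0; elim: n A => [//|n IH] A hA.
have [B hB] := horner_bounded (A %/ 'X) s.
have AE : A = (A %/ 'X) * 'X + (A`_0)%:P.
  by rewrite -horner_coef0 {1}(divp_eq A 'X) -['X]subr0 -polyC0 modp_XsubC.
have A0 : A`_0 = 0.
  apply: Normc.eq0_normc; apply/eqP; rewrite eq_le normc_ge0 andbT.
  apply/ler_addgt0Pr => e e0; rewrite add0r.
  pose M := `|C| * s ^+ n + `|B| + 1.
  have M0 : 0 < M by rewrite ltr_wpDl// addr_ge0// mulr_ge0// exprn_ge0// ltW.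
  (* The constant term is at most [t * M] for every real [t] in []0, s[]; this choice makes it at
     most [e]. *)
  pose t := Num.min (s / 2) (e / M).
  have t0 : 0 < t by rewrite lt_min !divr_gt0.
  have ts : t < s by rewrite gt_min; apply/orP; left; rewrite ltr_pdivrMr// ltr_pMr// ltr1n.
  have tc : normc t%:C%C = t by rewrite normc_real gtr0_norm.
  have tn0 : (t%:C)%C != 0 by apply/eqP => -[t00]; rewrite t00 ltxx in t0.
  have := hA _ tn0; rewrite tc => /(_ ts) h.
  have -> : A`_0 = A.[(t%:C)%C] - (A %/ 'X).[(t%:C)%C] * (t%:C)%C.
    by rewrite {2}AE !hornerE addrC addKr.
  apply: le_trans (ler_normcD _ _) _; rewrite normcN Normc.normcM tc.
  have hb : normc (A %/ 'X).[(t%:C)%C] <= `|B|.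
    by apply: le_trans (ler_norm B); apply: hB; rewrite tc ltW.
  apply: (@le_trans _ _ (t * M)); last first.
    by rewrite -ler_pdivlMr// ge_min lexx orbT.
  have : C * t ^+ n.+1 <= t * (`|C| * s ^+ n).
    rewrite exprS mulrCA ler_wpM2l ?(ltW t0)//.
    apply: le_trans (_ : `|C| * t ^+ n <= _).
      by rewrite ler_wpM2r ?exprn_ge0 ?(ltW t0)// ler_norm.
    by rewrite ler_wpM2l// lerXn2r ?nnegrE ?(ltW t0) ?(ltW s0)// ltW.
  have : normc (A %/ 'X).[(t%:C)%C] * t <= t * `|B|.
    by rewrite mulrC ler_wpM2l ?(ltW t0).
  by rewrite /M !mulrDr mulr1; move: (ltW t0) h; lra.
move=> [//|k] kn; rewrite AE A0 polyC0 addr0 coefMX /=.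
apply: IH => // v v0 vs; have := hA v v0 vs.
rewrite {1}AE A0 polyC0 addr0 hornerM hornerX Normc.normcM exprSr mulrA.
by rewrite ler_pM2r// lt_def normc_ge0 andbT; apply: contra v0 => /eqP/Normc.eq0_normc ->.
Qed.

End Majorants.

Section GermVanishing.
Variables (R : realType) (d : nat) (Q : nat -> {poly R[i]}) (M : nat -> R[i])
  (g : R[i] -> R[i]) (b rho : R).
Local Notation normc := (@Normc.normc R).
Hypotheses (b0 : 0 <= b) (rho0 : 0 < rho) (Mb : forall k, normc (M k) <= b * rho ^+ k).
Hypothesis gM : forall v N, normc v * rho < 1 ->
  normc (g v - \sum_(k < N) M k * v ^+ k.+1) <=
    b * normc v * (normc v * rho) ^+ N / (1 - normc v * rho).

(** [p N] is the truncation of the series of [g] and [m N] its geometric majorant; [A N] is the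
    left-hand side of the equation with [g] truncated, and [B N] majorizes it coefficientwise. *)
Let p N : {poly R[i]} := \sum_(k < N) M k *: 'X^(k.+1).
Let m N : {poly R} := \sum_(k < N) (b * rho ^+ k) *: 'X^(k.+1).
Let A N : {poly R[i]} := \sum_(j < d) Q j * p N ^+ j.
Let B N : {poly R} := \sum_(j < d) majorant (Q j) * m N ^+ j.

Let pE N v : (p N).[v] = \sum_(k < N) M k * v ^+ k.+1.
Proof. by rewrite horner_sum; apply: eq_bigr => k _; rewrite hornerZ hornerXn. Qed.

Let mE N (s : R) : 0 <= s -> s * rho < 1 -> 0 <= (m N).[s] <= b * s / (1 - s * rho).
Proof.
move=> s0 sr; have d0 : 0 < 1 - s * rho by rewrite subr_gt0.
have -> : (m N).[s] = b * s * \sum_(k < N) (s * rho) ^+ k.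
  rewrite horner_sum mulr_sumr; apply: eq_bigr => k _.
  by rewrite hornerZ hornerXn exprMn exprS; ring.
have sr0 : 0 <= s * rho by rewrite mulr_ge0// ltW.
have geo : \sum_(k < N) (s * rho) ^+ k <= (1 - s * rho)^-1.
  rewrite -[leRHS]mul1r ler_pdivlMr// mulrC.
  by rewrite -opprB mulNr -subrX1 opprB gerBl exprn_ge0.
apply/andP; split; first by rewrite !mulr_ge0// sumr_ge0// => k _; rewrite exprn_ge0.
by rewrite ler_wpM2l// mulr_ge0.
Qed.

Let p_maj N : majorized (p N) (m N).
Proof.
apply: (@majorized_sum R N (fun k => M k *: 'X^(k.+1)) (fun k => (b * rho ^+ k) *: 'X^(k.+1))).
move=> k i; rewrite !coefZ !coefXn; case: (i == k.+1); by rewrite ?mulr1 ?mulr0 ?Normc.normc0.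
Qed.

Let A_maj N : majorized (A N) (B N).
Proof.
apply: (@majorized_sum R d (fun j => Q j * p N ^+ j) (fun j => majorant (Q j) * m N ^+ j)) => j.
by apply: majorizedM; [exact: majorantP|exact: majorizedX].
Qed.

(** The bound is uniform in [N], as the geometric majorant converges at [s]. *)
Let B_bound (s : R) : 0 <= s -> s * rho < 1 -> exists C, forall N, (B N).[s] <= C.
Proof.
move=> s0 sr; exists (\sum_(j < d) (majorant (Q j)).[s] * (b * s / (1 - s * rho)) ^+ j) => N.
rewrite /B horner_sum; apply: ler_sum => j _; rewrite hornerM horner_exp.
have /andP[m0 mW] := mE N s0 sr.
apply: ler_wpM2l; last by rewrite lerXn2r ?nnegrE// (le_trans m0).
rewrite horner_coef sumr_ge0// => i _; rewrite mulr_ge0 ?exprn_ge0//.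
by apply: le_trans (majorantP (Q j) i); exact: normc_ge0.
Qed.

Let H v := \sum_(j < d) (Q j).[v] * g v ^+ j.

Let AE N v : (A N).[v] = \sum_(j < d) (Q j).[v] * (p N).[v] ^+ j.
Proof. by rewrite horner_sum; apply: eq_bigr => j _; rewrite hornerM horner_exp. Qed.

(** [W] bounds both [g] and its truncations, so the Lipschitz estimate for powers carries the
    remainder of [g] over to the equation. The extra factor [normc v] gives vanishing to order
    [N.+1] instead of [N]. *)
Let H_close (s : R) : 0 <= s -> s * rho < 1 -> exists2 C, 0 <= C & forall N v, normc v <= s ->
  normc (H v - (A N).[v]) <= C * normc v * (normc v * rho) ^+ N.
Proof.
move=> s0 sr; have ds0 : 0 < 1 - s * rho by rewrite subr_gt0.
pose W := b * s / (1 - s * rho).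
have W0 : 0 <= W by rewrite divr_ge0 ?mulr_ge0// ltW.
have [BQ hBQ] := choice (fun j : nat => horner_bounded (Q j) s).
pose C := (\sum_(j < d) `|BQ j| * (j%:R * W ^+ j.-1)) * (b / (1 - s * rho)).
have S0 : 0 <= \sum_(j < d) `|BQ j| * (j%:R * W ^+ j.-1).
  by apply: sumr_ge0 => j _; rewrite !mulr_ge0// exprn_ge0.
exists C => [|N v vs]; first by rewrite mulr_ge0// divr_ge0// ltW.
have v0 := normc_ge0 v.
have vr : normc v * rho < 1 by apply: le_lt_trans sr; rewrite ler_wpM2r// ltW.
have dv : 1 - s * rho <= 1 - normc v * rho by rewrite lerD2l lerN2 ler_wpM2r// ltW.
have bv0 : 0 <= b * normc v by rewrite mulr_ge0.
have vW : b * normc v / (1 - normc v * rho) <= W.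
  rewrite /W ler_pM ?invr_ge0 ?subr_ge0 ?(ltW vr)//; first by rewrite ler_wpM2l.
  by rewrite lef_pV2 ?posrE ?subr_gt0.
have gW : normc (g v) <= W.
  have := gM 0 vr; rewrite big_ord0 subr0 expr0 mulr1 => h; exact: le_trans h vW.
have pW : normc (p N).[v] <= W.
  have := majorized_vanishing (n := 0) (@p_maj N) _ (lexx (normc v)).
  have [vz|vn] := eqVneq v 0.
    rewrite vz => _; rewrite horner_sum big1 ?Normc.normc0// => k _.
    by rewrite hornerZ hornerXn expr0n mulr0.
  have vp : 0 < normc v.
    by rewrite lt_def v0 andbT; apply: contra vn => /eqP/Normc.eq0_normc ->.
  move=> /(_ vp) h; have {}h := h (fun k => ltac:(by [])).
  rewrite expr0 mul1r in h; apply: le_trans h _.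
  by have /andP[_ h2] := mE N v0 vr; exact: le_trans h2 vW.
rewrite AE /H -sumrB; apply: le_trans (ler_normc_sum _ _ _) _.
apply: (@le_trans _ _ (\sum_(j < d) `|BQ j| * (j%:R * W ^+ j.-1) * normc (g v - (p N).[v]))).
  apply: ler_sum => j _; rewrite -mulrBr Normc.normcM -mulrA ler_pM ?normc_ge0//.
    exact: le_trans (hBQ j v vs) (ler_norm _).
  by apply: le_trans (normc_subX j gW pW) _; rewrite mulrAC.
rewrite -mulr_suml /C -!mulrA ler_wpM2l//.
apply: (@le_trans _ _ (b * normc v * (normc v * rho) ^+ N / (1 - normc v * rho))).
  by rewrite pE; exact: gM.
have x0 : 0 <= b * normc v * (normc v * rho) ^+ N.
  by rewrite mulr_ge0// exprn_ge0// mulr_ge0// ltW.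
apply: (@le_trans _ _ (b * normc v * (normc v * rho) ^+ N / (1 - s * rho))).
  by rewrite ler_wpM2l// lef_pV2 ?posrE ?subr_gt0.
by rewrite le_eqVlt; apply/orP; left; apply/eqP; ring.
Qed.

(* Truncating [g] at order [N] yields a polynomial [A N] divisible by [v ^ N.+1]
   and majorized by [B N], whose values at some [s > |v|] are bounded in [N]; so
   [(A N).[v]] tends to [0], and also to the sum below. *)
Lemma poly_germ_vanish (s0 : R) : 0 < s0 ->
  (forall v, v != 0 -> normc v < s0 -> \sum_(j < d) (Q j).[v] * g v ^+ j = 0) ->
  forall v, normc v * rho < 1 -> \sum_(j < d) (Q j).[v] * g v ^+ j = 0.
Proof.
move=> s00 H0 v vr; rewrite -/(H v).
have v0 := normc_ge0 v.
have A0 N k : (k < N.+1)%N -> (A N)`_k = 0.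
  pose s1 := Num.min s0 (rho^-1 / 2).
  have s10 : 0 < s1 by rewrite lt_min s00 divr_gt0// invr_gt0.
  have s1r : s1 * rho < 1.
    rewrite -ltr_pdivlMr// mul1r gt_min; apply/orP; right.
    by rewrite ltr_pdivrMr// ltr_pMr ?invr_gt0// ltr1n.
  have [C C0 hC] := H_close (ltW s10) s1r.
  apply: (@coef_eq0_bigO R (A N) N.+1 (C * rho ^+ N) s1 s10) => u u0 us.
  have Hu : H u = 0 by apply: H0 => //; apply: lt_le_trans us _; rewrite ge_min lexx.
  have := hC N u (ltW us); rewrite Hu sub0r normcN => h; apply: le_trans h _.
  by rewrite le_eqVlt; apply/orP; left; apply/eqP; rewrite exprMn exprS; ring.
(* Midway between [|v|] and the radius of convergence: both ratios [|v| / s] and [|v| rho] are less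
   than 1, as [le0_geometric] requires. *)
pose s := (normc v + rho^-1) / 2.
have vri : normc v < rho^-1 by rewrite -[ltRHS]mul1r ltr_pdivlMr.
have ri0 : 0 < rho^-1 by rewrite invr_gt0.
have vs : normc v < s by rewrite ltr_pdivlMr// mulrDr mulr1 ltrD2l.
have s_gt0 : 0 < s by exact: le_lt_trans vs.
have sr : s * rho < 1.
  rewrite -ltr_pdivlMr// mul1r ltr_pdivrMr// mulrDr mulr1; lra.
have [CB hB] := B_bound (ltW s_gt0) sr.
have [C C0 hC] := H_close v0 vr.
apply: Normc.eq0_normc; apply/eqP; rewrite eq_le normc_ge0 andbT.
apply: (@le0_geometric R _ CB (C * normc v) (normc v / s) (normc v * rho)).
- by rewrite divr_ge0 ?(ltW s_gt0)//= ltr_pdivrMr// mul1r.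
- by rewrite mulr_ge0 ?(ltW rho0).
move=> N; have -> : H v = (A N).[v] + (H v - (A N).[v]) by rewrite addrC subrK.
apply: le_trans (ler_normcD _ _) _; apply: lerD; last exact: hC.
have t0 : 0 <= normc v / s by rewrite divr_ge0 ?(ltW s_gt0).
have t1 : normc v / s <= 1 by rewrite ler_pdivrMr// mul1r ltW.
have B0 : 0 <= (B N).[s].
  rewrite horner_coef sumr_ge0// => i _; rewrite mulr_ge0 ?exprn_ge0 ?(ltW s_gt0)//.
  by apply: le_trans (A_maj N i); exact: normc_ge0.
apply: le_trans (majorized_vanishing (@A_maj N) s_gt0 (ltW vs) (A0 N)) _.
rewrite exprS -mulrA mulrC; apply: le_trans (_ : (normc v / s) ^+ N * (B N).[s] <= _).
  by rewrite -[leRHS]mulr1 ler_wpM2l// mulr_ge0// exprn_ge0.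
by rewrite mulrC ler_wpM2r// exprn_ge0.
Qed.

End GermVanishing.

(** * Cauchy transforms off the support *)

Section ComplexIntegral.
Variables (R : realType) (mu : plane_measure R) (K : set (R * R)).
Hypotheses (cK : compact K) (muK : mu (~` K) = 0%E).
Local Notation normc := (@Normc.normc R).
Local Notation C := R[i].
Implicit Types f g : R * R -> C.

Let mK : measurable (K : set (plane R)) := compact_measurable_plane cK.

Local Notation CI f := (Cintegral mu setT f).

Definition cintegrable f := mu.-integrable setT (EFin \o (fun z => complex.Re (f z))) /\
  mu.-integrable setT (EFin \o (fun z => complex.Im (f z))).

Lemma ReD (x y : C) : complex.Re (x + y) = complex.Re x + complex.Re y.
Proof. by case: x => ? ?; case: y. Qed.

Lemma ImD (x y : C) : complex.Im (x + y) = complex.Im x + complex.Im y.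
Proof. by case: x => ? ?; case: y. Qed.

Lemma ReM (x y : C) : complex.Re (x * y) =
  complex.Re x * complex.Re y - complex.Im x * complex.Im y.
Proof. by case: x => ? ?; case: y. Qed.

Lemma ImM (x y : C) : complex.Im (x * y) =
  complex.Re x * complex.Im y + complex.Im x * complex.Re y.
Proof. by case: x => ? ?; case: y. Qed.

Lemma cintegrable_on f (M : R) : cmeasurable (f : plane R -> C) ->
  (forall z, K z -> normc (f z) <= M) -> cintegrable f.
Proof.
move=> [rf jf] fM; split; apply: (integrable_on mK muK) => // z Kz;
  apply: le_trans (fM z Kz); [exact: normr_Re_le|exact: normr_Im_le].
Qed.

Lemma cintegrableD f g : cintegrable f -> cintegrable g -> cintegrable (fun z => f z + g z).
Proof.
move=> [rf jf] [rg jg]; split.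
- have := integrableD measurableT rf rg; apply: eq_integrable => // z _.
  by rewrite /= ReD.
- have := integrableD measurableT jf jg; apply: eq_integrable => // z _.
  by rewrite /= ImD.
Qed.

Lemma CintegralD f g : cintegrable f -> cintegrable g ->
  CI (fun z => f z + g z) = CI f + CI g.
Proof.
move=> [rf jf] [rg jg]; rewrite /Cintegral.
rewrite -[RHS]/((_ + _) +i* (_ + _))%C -!RintegralD//.
by congr (_ +i* _)%C; apply: eq_Rintegral => z _; rewrite ?ReD ?ImD.
Qed.

Lemma cintegrableZ (c : C) f : cintegrable f -> cintegrable (fun z => c * f z).
Proof.
have Zr (r : R) (h : R * R -> R) : mu.-integrable setT (EFin \o h) ->
    mu.-integrable setT (EFin \o (fun z => r * h z)).
  by move=> ih; have := integrableZl measurableT r ih; apply: eq_integrable.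
move=> [rf jf]; split.
- have := integrableB measurableT (Zr (complex.Re c) _ rf) (Zr (complex.Im c) _ jf).
  by apply: eq_integrable => // z _; rewrite /= ReM.
- have := integrableD measurableT (Zr (complex.Re c) _ jf) (Zr (complex.Im c) _ rf).
  by apply: eq_integrable => // z _; rewrite /= ImM.
Qed.

Lemma CintegralZ (c : C) f : cintegrable f -> CI (fun z => c * f z) = c * CI f.
Proof.
have Zr (r : R) (h : R * R -> R) : mu.-integrable setT (EFin \o h) ->
    mu.-integrable setT (EFin \o (fun z => r * h z)).
  by move=> ih; have := integrableZl measurableT r ih; apply: eq_integrable.
case: c => r s [rf jf]; rewrite /Cintegral.
rewrite -[RHS]/((_ - _) +i* (_ + _))%C -!RintegralZl//.
rewrite -RintegralB; [|by []|exact: Zr..].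
rewrite -RintegralD; [|by []|exact: Zr..].
by congr (_ +i* _)%C; apply: eq_Rintegral => z _; rewrite ?ReM ?ImM.
Qed.

Lemma cintegrable0 : cintegrable (fun=> 0).
Proof. by split; exact: integrable0. Qed.

Lemma cintegrable_sum N (F : nat -> R * R -> C) : (forall k, cintegrable (F k)) ->
  cintegrable (fun z => \sum_(k < N) F k z).
Proof.
move=> iF; elim: N => [|N IH].
  rewrite (_ : (fun z => _) = fun=> 0); first exact: cintegrable0.
  by apply/funext => z; rewrite big_ord0.
rewrite (_ : (fun z => _) = fun z => \sum_(k < N) F k z + F N z); first exact: cintegrableD.
by apply/funext => z; rewrite big_ord_recr.
Qed.

Lemma Cintegral_sum N (F : nat -> R * R -> C) : (forall k, cintegrable (F k)) ->
  CI (fun z => \sum_(k < N) F k z) = \sum_(k < N) CI (F k).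
Proof.
move=> iF; elim: N => [|N IH].
  rewrite (_ : (fun z => _) = fun z => 0 * (0 : C)).
    by rewrite (CintegralZ 0 cintegrable0) mul0r big_ord0.
  by apply/funext => z; rewrite big_ord0 mul0r.
rewrite (_ : (fun z => _) = fun z => \sum_(k < N) F k z + F N z); last first.
  by apply/funext => z; rewrite big_ord_recr.
by rewrite CintegralD ?IH ?big_ord_recr//; exact: cintegrable_sum.
Qed.

(** The factor 2 comes from bounding the real and imaginary parts separately; any constant
    independent of the integrand would do. *)
Lemma normc_Cintegral_le f (M : R) : cintegrable f -> (forall z, K z -> normc (f z) <= M) ->
  normc (CI f) <= 2 * fine (mu setT) * M.
Proof.
move=> [rf jf] fM; apply: le_trans (normc_le_ReIm _) _ => /=.
rewrite -mulrA mulrDl mul1r mulrC; apply: lerD; apply: (normr_Rintegral_on mK muK) => // z Kz;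
  apply: le_trans (fM z Kz); [exact: normr_Re_le|exact: normr_Im_le].
Qed.

Lemma cmeasurableV d (T : measurableType d) (f : T -> C) :
  cmeasurable f -> cmeasurable (fun x => (f x)^-1).
Proof.
move=> [rf jf].
have mn : measurable_fun setT (fun x => (complex.Re (f x) ^+ 2 + complex.Im (f x) ^+ 2)^-1).
  apply: measurable_inv_nneg => [|x]; last by rewrite addr_ge0 ?sqr_ge0.
  by apply: measurable_funD; exact: measurable_funX.
split.
- rewrite (_ : _ \o _ = fun x => complex.Re (f x) *
    (complex.Re (f x) ^+ 2 + complex.Im (f x) ^+ 2)^-1); first exact: measurable_funM.
  by apply/funext => x /=; case: (f x).
- rewrite (_ : _ \o _ = fun x => - (complex.Im (f x) *
    (complex.Re (f x) ^+ 2 + complex.Im (f x) ^+ 2)^-1)).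
    by apply: measurableT_comp => //; exact: measurable_funM.
  by apply/funext => x /=; case: (f x).
Qed.

Definition moment (c : C) k : C := CI (fun zeta => (toC zeta - c) ^+ k).

Lemma cmeasurable_sub (c : C) : cmeasurable ((fun zeta => toC zeta - c) : plane R -> C).
Proof. by apply: cmeasurableD; [exact: cmeasurable_toC|exact: cmeasurable_cst]. Qed.

Section Expansion.
Variables (c : C) (rho : R).
Hypotheses (rho0 : 0 <= rho) (Krho : forall zeta, K zeta -> normc (toC zeta - c) <= rho).

Let ipow k : cintegrable (fun zeta => (toC zeta - c) ^+ k).
Proof.
apply: (@cintegrable_on _ (rho ^+ k)).
  by apply: cmeasurableX; exact: cmeasurable_sub.
by move=> z Kz; rewrite normcX lerXn2r ?nnegrE ?normc_ge0// Krho.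
Qed.

Lemma normc_moment k : normc (moment c k) <= 2 * fine (mu setT) * rho ^+ k.
Proof.
apply: normc_Cintegral_le => // z Kz.
by rewrite normcX lerXn2r ?nnegrE ?normc_ge0// Krho.
Qed.

(** With [y = zeta - c], the kernel is [v / (1 - v y)], a geometric series with remainder
    [v (v y)^N / (1 - v y)], to be integrated over [K], where [|v y| <= |v| rho < 1]. *)
Lemma cauchy_expansion z (N : nat) v : v = (toC z - c)^-1 -> v != 0 -> normc v * rho < 1 ->
  normc (cauchy_transform mu z - \sum_(k < N) moment c k * v ^+ k.+1) <=
    2 * fine (mu setT) * normc v * (normc v * rho) ^+ N / (1 - normc v * rho).
Proof.
move=> vdef v0 vr.
have d0 : 0 < 1 - normc v * rho by rewrite subr_gt0.
have zv : toC z - c = v^-1 by rewrite vdef invrK.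
have y1 zeta : K zeta -> 1 - normc v * rho <= normc (1 - v * (toC zeta - c)).
  move=> Kz; rewrite lerBlDr.
  have := ler_normcD (1 - v * (toC zeta - c)) (v * (toC zeta - c)).
  rewrite subrK Normc.normc1 Normc.normcM => h; apply: le_trans h _.
  by rewrite lerD2l ler_wpM2l ?normc_ge0// Krho.
pose Rm zeta := (toC z - toC zeta)^-1 - \sum_(k < N) v ^+ k.+1 * (toC zeta - c) ^+ k.
have RmE zeta : K zeta -> Rm zeta = v * (v * (toC zeta - c)) ^+ N / (1 - v * (toC zeta - c)).
  move=> Kz; set y := toC zeta - c.
  have ny : 1 - v * y != 0.
    apply/eqP => h; have := y1 zeta Kz; rewrite -/y h Normc.normc0.
    by rewrite leNgt d0.
  rewrite /Rm; have -> : (toC z - toC zeta)^-1 = v / (1 - v * y).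
    rewrite (_ : toC z - toC zeta = v^-1 - y); last by rewrite -zv /y opprB addrA subrK.
    have -> : v^-1 - y = v^-1 * (1 - v * y) by rewrite mulrBr mulr1 mulrA mulVf// mul1r.
    by rewrite invfM invrK.
  rewrite (_ : \sum_(k < N) _ = v * \sum_(k < N) (v * y) ^+ k); last first.
    by rewrite mulr_sumr; apply: eq_bigr => k _; rewrite exprMn exprS mulrA.
  apply: (mulIf ny); rewrite mulrBl mulfVK// mulfVK//.
  have geo : (\sum_(k < N) (v * y) ^+ k) * (1 - v * y) = 1 - (v * y) ^+ N.
    by rewrite mulrC -opprB mulNr -subrX1 opprB.
  by rewrite -mulrA geo mulrBr mulr1 opprB addrC subrK.
have isum : cintegrable (fun zeta => \sum_(k < N) v ^+ k.+1 * (toC zeta - c) ^+ k).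
  by apply: (@cintegrable_sum N (fun k zeta => v ^+ k.+1 * (toC zeta - c) ^+ k)) => k;
    exact: cintegrableZ.
have Rmb zeta : K zeta -> normc (Rm zeta) <= normc v * (normc v * rho) ^+ N / (1 - normc v * rho).
  move=> Kz; rewrite RmE// !Normc.normcM Normc.normcV normcX Normc.normcM.
  have vy0 y : 0 <= normc v * normc y by rewrite mulr_ge0 ?normc_ge0.
  apply: ler_pM.
  - by apply: mulr_ge0; [exact: normc_ge0|apply: exprn_ge0; exact: vy0].
  - by rewrite invr_ge0 normc_ge0.
  - apply: ler_wpM2l; first exact: normc_ge0.
    have h : normc v * normc (toC zeta - c) <= normc v * rho.
      by rewrite ler_wpM2l ?normc_ge0// Krho.
    by rewrite lerXn2r ?nnegrE// (le_trans _ h).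
  - by rewrite lef_pV2 ?posrE ?y1// (lt_le_trans d0)// y1.
have iRm : cintegrable Rm.
  apply: (cintegrable_on _ Rmb).
  apply: cmeasurableD.
    apply: cmeasurableV; apply: cmeasurableD; first exact: cmeasurable_cst.
    rewrite (_ : (fun x => _) = fun x => -1 * toC x); last by apply/funext => x; rewrite mulN1r.
    by apply: cmeasurableM; [exact: cmeasurable_cst|exact: cmeasurable_toC].
  rewrite (_ : (fun x => _) = fun x => -1 * \sum_(k < N) v ^+ k.+1 * (toC x - c) ^+ k); last first.
    by apply/funext => x; rewrite mulN1r.
  apply: cmeasurableM; first exact: cmeasurable_cst.
  apply: (@cmeasurable_sum _ _ _ N (fun k x => v ^+ k.+1 * (toC x - c) ^+ k)) => k.
  apply: cmeasurableM; first exact: cmeasurable_cst.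
  by apply: cmeasurableX; exact: cmeasurable_sub.
have -> : cauchy_transform mu z = CI Rm + \sum_(k < N) moment c k * v ^+ k.+1.
  rewrite /cauchy_transform (_ : (fun zeta => (toC z - toC zeta)^-1) =
    fun zeta => Rm zeta + \sum_(k < N) v ^+ k.+1 * (toC zeta - c) ^+ k); last first.
    by apply/funext => zeta; rewrite subrK.
  rewrite CintegralD//; congr (_ + _).
  rewrite (@Cintegral_sum N (fun k zeta => v ^+ k.+1 * (toC zeta - c) ^+ k)).
    by apply: eq_bigr => k _; rewrite CintegralZ// mulrC.
  by move=> k; exact: cintegrableZ.
rewrite addrK; apply: le_trans (normc_Cintegral_le iRm Rmb) _.
by rewrite !mulrA.
Qed.

End Expansion.
End ComplexIntegral.

(** * The germ near infinity, and discs separating points from a convex set *)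

Section GermAtInfinity.
Variable R : realType.
Local Notation normc := (@Normc.normc R).

Lemma germ_value_cauchy (f : germ R) (mu : plane_measure R) (K : set (R * R)) (rho : R) z :
  compact K -> mu (~` K) = 0%E -> 0 < rho -> (forall zeta, K zeta -> normc (toC zeta) <= rho) ->
  (forall n, Cintegral mu setT (fun zeta => toC zeta ^+ n) = f n) ->
  rho < normc (toC z) -> germ_value f (toC z) = cauchy_transform mu z.
Proof.
move=> cK muK rho0 Krho fE zr.
have nz : toC z != 0.
  by apply/eqP => z0; move: zr; rewrite z0 Normc.normc0 ltNge (ltW rho0).
pose v := (toC z - 0)^-1.
have vE : v = (toC z)^-1 by rewrite /v subr0.
have v0 : v != 0 by rewrite vE invr_eq0.
have nz0 : 0 < normc (toC z) by exact: lt_trans zr.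
have vr : normc v * rho < 1 by rewrite vE Normc.normcV mulrC ltr_pdivrMr// mul1r.
have Krho0 zeta : K zeta -> normc (toC zeta - 0) <= rho by rewrite subr0; exact: Krho.
have mE k : moment mu 0 k = f k.
  by rewrite -fE; congr (Cintegral _ _ _); apply/funext => zeta; rewrite subr0.
have bound N : normc (cauchy_transform mu z - \sum_(k < N) f k * v ^+ k.+1) <=
    2 * fine (mu setT) * normc v * (normc v * rho) ^+ N / (1 - normc v * rho).
  have := cauchy_expansion cK muK (ltW rho0) Krho0 N (erefl v) v0 vr.
  by rewrite (eq_bigr (fun k : 'I_N => f k * v ^+ k.+1)) => // k _; rewrite mE.
clearbody v.
rewrite /germ_value; apply: (@cvg_lim (R[i]^o)); first exact: norm_hausdorff.
apply/cvgrPdist_lt => e e0.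
(* Norms in [R[i]] are complex numbers, and so is the tolerance [e]; being positive, it is real. *)
have eE : e = ((complex.Re e)%:C)%C.
  by move: e0; case: (e) => a b; rewrite ltcE /= => /andP[/eqP -> _].
have re0 : 0 < complex.Re e by move: e0; rewrite eE ltcR.
rewrite eE; set a := complex.Re e in re0 *.
pose M := 2 * fine (mu setT) * normc v / (1 - normc v * rho).
have : (fun N : nat => M * (normc v * rho) ^+ N) @ \oo --> M * 0.
  apply: cvgMl_tmp; apply: cvg_expr.
  by rewrite ger0_norm// mulr_ge0 ?normc_ge0// ltW.
rewrite mulr0 => /cvgrPdist_lt/(_ a re0); apply: filterS => N /=.
rewrite sub0r normrN => hN; rewrite -normcE ltcR.
have -> : series (fun n => f n / toC z ^+ n.+1) N =
    \sum_(k < N) f k * v ^+ k.+1.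
  by rewrite /series /= big_mkord; apply: eq_bigr => k _; rewrite vE exprVn.
apply: le_lt_trans (bound N) _; apply: le_lt_trans hN.
apply: le_trans (ler_norm _); rewrite /M le_eqVlt; apply/orP; left; apply/eqP; ring.
Qed.

Definition inner (x y : R * R) : R := x.1 * y.1 + x.2 * y.2.

Lemma compact_convex_disc (K : set (R * R)) z : compact K ->
  convex_set (K : set (convex_lmodType (R * R)%type)) -> ~ K z ->
  exists c rho, [/\ 0 < rho, forall zeta, K zeta -> normc (toC zeta - toC c) <= rho &
    rho < normc (toC z - toC c)].
Proof.
move=> cK convK Kz.
have ncE (x y : R * R) : normc (toC x - toC y) = Num.sqrt (sqnorm (x - y)) by [].
have [K0|/set0P/negP/negPn/eqP K0] := pselect (K !=set0); last first.
  exists (z + (2, 0)), 1; split => //; first by move=> zeta; rewrite K0.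
  rewrite ncE /sqnorm /= opprD addrA subrr add0r addr0 subrr expr0n addr0 sqrrN.
  by rewrite sqrtr_sqr ger0_norm// ltr1n.
have cdist : {within K, continuous (fun y : R * R => sqnorm (y - z))}.
  apply: continuous_subspaceT => y; apply: (@continuous_comp _ _ _ (fun y : R * R => y - _) (@sqnorm R));
      last exact: continuous_sqnorm.
  by apply: cvgB; [exact: cvg_id|exact: cvg_cst].
have [p pK pmin] := compact_EVT_min K0 cK cdist.
pose v := z - p.
have v0 : 0 < sqnorm v.
  rewrite lt_def sqnorm_ge0 andbT; apply/eqP => /eqP.
  rewrite paddr_eq0 ?sqr_ge0// !sqrf_eq0 => /andP[/eqP h1 /eqP h2].
  apply: Kz; have -> : z = p.
    by apply/eqP; rewrite -subr_eq0; apply/eqP; rewrite -/v (surjective_pairing v) h1 h2.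
  exact: set_mem.
have obtuse q : K q -> inner (q - p) v <= 0.
  move=> Kq; rewrite leNgt; apply/negP => ip.
  pose D := sqnorm (q - p); have D0 : 0 <= D by exact: sqnorm_ge0.
  (* If the angle were acute, moving from [p] by the fraction [l] towards [q] would come closer to
     [z]: minimality of [p] gives [2 inner (q - p) v <= l D], which is at most [inner (q - p) v]. *)
  pose l := Num.min 1 (inner (q - p) v / (D + 1)).
  have D1 : 0 < D + 1 by rewrite ltr_wpDl.
  have l0 : 0 < l by rewrite lt_min ltr01 divr_gt0.
  have l1 : l <= 1 by rewrite ge_min lexx.
  have lD : l * (D + 1) <= inner (q - p) v by rewrite -ler_pdivlMr// ge_min lexx orbT.
  have li : Itv.spec (@Itv.num_sem R) (Itv.Real `[0%Z, 1%Z]) l.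
    by rewrite /= /Itv.num_sem /= num_real /= in_itv /= (ltW l0) l1.
  have := convK q p (Itv.mk li) (mem_set Kq) pK.
  move/pmin.
  rewrite -[X in _ <= sqnorm (X - z)]/(l *: q + (1 - l) *: p).
  have -> : l *: q + (1 - l) *: p - z = l *: (q - p) - v.
    rewrite /v scalerBl scale1r scalerBr opprB !addrA; congr (_ - z).
    by rewrite addrAC -!addrA; congr (_ + _); rewrite addrC.
  have -> : p - z = - v by rewrite /v opprB.
  rewrite /sqnorm /= => h; move: lD ip; rewrite /D /sqnorm /inner.
  move: h; rewrite /= /GRing.scale /=.
  set a := (q.1 - p.1); set b := (q.2 - p.2); set s := v.1; set t := v.2 => h lD ip.
  have : l * (2 * (a * s + b * t)) <= l * (l * (a ^+ 2 + b ^+ 2)) by nra.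
  rewrite ler_pM2l// => h2; nra.
have [Q hQ] : exists Q, forall q, K q -> sqnorm (q - p) <= Q.
  have [|m _ hm] := @compact_EVT_max _ _ (fun y : R * R => sqnorm (y - p)) K K0 cK.
    apply: continuous_subspaceT => y; apply: (@continuous_comp _ _ _ (fun y : R * R => y - _) (@sqnorm R));
      last exact: continuous_sqnorm.
    by apply: cvgB; [exact: cvg_id|exact: cvg_cst].
  by exists (sqnorm (m - p)) => q Kq; apply: hm; exact: mem_set.
pose Q1 := `|Q| + 1; have Q10 : 0 < Q1 by rewrite ltr_wpDl.
(* Chosen so that [2 t |v|^2 = Q1]: the squared distance from the centre to [z] then exceeds [r2] by
   exactly [|v|^2]. *)
pose t := Q1 / (2 * sqnorm v); have t0 : 0 < t by rewrite divr_gt0// mulr_gt0.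
pose r2 := t ^+ 2 * sqnorm v + Q1.
have r20 : 0 < r2 by rewrite ltr_wpDl// mulr_ge0 ?sqr_ge0// sqnorm_ge0.
exists (p - t *: v), (Num.sqrt r2); split; first by rewrite sqrtr_gt0.
- move=> q Kq; rewrite ncE ler_wsqrtr//.
  have -> : sqnorm (q - (p - t *: v)) =
      sqnorm (q - p) + 2 * t * inner (q - p) v + t ^+ 2 * sqnorm v.
    by rewrite /sqnorm /inner /= /GRing.scale /=; ring.
  have h1 := obtuse q Kq; have h2 := hQ q Kq.
  have h3 : 2 * t * inner (q - p) v <= 0 by rewrite mulr_ge0_le0// mulr_ge0// ltW.
  by rewrite /r2 /Q1; have := ler_norm Q; move: h2 h3; lra.
rewrite ncE ltr_sqrt; last first.
  rewrite (_ : z - _ = v + t *: v); last by rewrite opprB addrCA addrC.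
  rewrite (_ : sqnorm _ = (1 + t) ^+ 2 * sqnorm v).
    by rewrite mulr_gt0// exprn_gt0// addr_gt0.
  by rewrite /sqnorm /= /GRing.scale /=; ring.
have -> : sqnorm (z - (p - t *: v)) = sqnorm v + 2 * t * sqnorm v + t ^+ 2 * sqnorm v.
  by rewrite opprB addrCA addrC -/v /sqnorm /= /GRing.scale /=; ring.
have -> : 2 * t * sqnorm v = Q1 by rewrite /t; field; rewrite gt_eqF.
by rewrite /r2; lra.
Qed.

End GermAtInfinity.

Section OffSupport.
Variable R : realType.
Local Notation normc := (@Normc.normc R).
Implicit Types (P : {poly {poly R[i]}}) (q : {poly R[i]}) (c v : R[i]).

Definition ofC (x : R[i]) : R * R := (complex.Re x, complex.Im x).

Lemma ofCK : cancel ofC (@toC R).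
Proof. by case. Qed.

Lemma toCK : cancel (@toC R) ofC.
Proof. by case. Qed.

(* [v ^ D * q (c + 1 / v)], a polynomial in [v] as soon as [size q <= D + 1]. *)
Definition reversal (D : nat) c q : {poly R[i]} :=
  \sum_(i < size (q \Po ('X + c%:P))) (q \Po ('X + c%:P))`_i *: 'X^(D - i).

Lemma reversalE D c q v : (size q <= D)%N -> v != 0 ->
  (reversal D c q).[v] = v ^+ D * q.[c + v^-1].
Proof.
move=> qD v0; rewrite /reversal horner_sum.
have -> : q.[c + v^-1] = (q \Po ('X + c%:P)).[v^-1].
  by rewrite horner_comp !hornerE addrC.
rewrite horner_coef mulr_sumr; apply: eq_bigr => i _.
have iD : (i <= D)%N.
  apply: leq_trans (ltnW (ltn_ord i)) _; apply: leq_trans qD.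
  by rewrite size_comp_poly2// size_XaddC.
rewrite hornerZ hornerXn mulrCA; congr (_ * _).
by rewrite exprVn -{2}(subnK iD) exprD mulfK// expf_neq0.
Qed.

(** In the variable [v = 1 / (z - c)], multiplication by a power of [v] makes the equation
    polynomial in [v] and [g v]. It holds near [v = 0] by the germ, extends to [|v| rho < 1], and
    the power of [v] cancels since [v] is not 0. *)
Lemma cauchy_off_support (f : germ R) P (K : set (R * R)) (mu : plane_measure R) z :
  compact K -> convex_set (K : set (convex_lmodType (R * R)%type)) ->
  annihilates P f -> mu (~` K) = 0%E ->
  (forall n, Cintegral mu setT (fun zeta => toC zeta ^+ n) = f n) ->
  ~ K z -> eval2 P (toC z) (cauchy_transform mu z) = 0.
Proof.
move=> cK convK [r annP] muK fE nKz.
have [rho0 hrho0] := compact_normc_bounded cK.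
have [c [rho [rho_gt0 Krho rhoz]]] := compact_convex_disc cK convK nKz.
set w := toC c in Krho rhoz.
(* The value at [v = 0] is that of the transform at infinity; it keeps the expansion valid there. *)
pose g v := if v == 0 then 0 else cauchy_transform mu (ofC (w + v^-1)).
have b0 : 0 <= 2 * fine (mu setT) by rewrite mulr_ge0// fine_ge0.
have gM v N : normc v * rho < 1 ->
    normc (g v - \sum_(k < N) moment mu w k * v ^+ k.+1) <=
      2 * fine (mu setT) * normc v * (normc v * rho) ^+ N / (1 - normc v * rho).
  move=> vr; rewrite /g; case: (eqVneq v 0) => [->|v0].
    rewrite big1 ?subr0 ?Normc.normc0 ?mulr0 ?mul0r// => k _.
    by rewrite expr0n mulr0.
  have vE : (toC (ofC (w + v^-1)) - w)^-1 = v by rewrite ofCK addrC addKr invrK.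
  exact: (cauchy_expansion cK muK (ltW rho_gt0) Krho N (esym vE) v0 vr).
pose sz (j : nat) := size (P`_j).
pose D := (\max_(j < size P) sz j)%N.
have PD j : (size (P`_j)%R <= D)%N.
  have [jP|Pj] := ltnP j (size P); last by rewrite nth_default// size_poly0.
  exact: (leq_bigmax (Ordinal jP)).
have HE v : v != 0 -> \sum_(j < size P) (reversal D w P`_j).[v] * g v ^+ j =
    v ^+ D * eval2 P (w + v^-1) (g v).
  move=> v0; rewrite eval2E mulr_sumr; apply: eq_bigr => j _.
  by rewrite reversalE// mulrA.
(* For [|v| < 1 / r1], the point [w + 1 / v] lies beyond the radius [r] of the germ equation and
   outside of a disc about 0 containing [K]. *)
pose r1 := `|r| + `|rho0| + normc w + 1.
have r10 : 0 < r1 by rewrite ltr_wpDl// !addr_ge0 ?normc_ge0.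
have H0 v : v != 0 -> normc v < r1^-1 ->
    \sum_(j < size P) (reversal D w P`_j).[v] * g v ^+ j = 0.
  move=> v0 vr; rewrite HE//.
  have vn0 : 0 < normc v.
    by rewrite lt_def normc_ge0 andbT; apply: contra v0 => /eqP/Normc.eq0_normc ->.
  have big : `|r| + `|rho0| + 1 < normc (w + v^-1).
    have h1 : r1 < normc v^-1 by rewrite Normc.normcV -[ltLHS]invrK ltf_pV2 ?posrE ?invr_gt0.
    have := ler_normcD (w + v^-1) (- w); rewrite normcN addrAC subrr add0r.
    by move: h1; rewrite /r1; lra.
  have gE : g v = germ_value f (w + v^-1).
    rewrite /g (negbTE v0) -[in RHS](ofCK (w + v^-1)).
    apply/esym; apply: (@germ_value_cauchy _ _ _ K (`|rho0| + 1)) => //.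
    - move=> zeta Kz; apply: le_trans (hrho0 zeta Kz) _.
      by apply: le_trans (ler_norm _) _; rewrite lerDl.
    - by rewrite ofCK; apply: le_lt_trans big; rewrite lerD2r lerDr.
  rewrite gE annP ?mulr0//; apply: le_lt_trans big.
  by apply: le_trans (ler_norm r) _; rewrite -addrA lerDl addr_ge0.
pose v := (toC z - w)^-1.
have zw0 : 0 < normc (toC z - w) by exact: lt_trans rhoz.
have zwn0 : toC z - w != 0.
  by apply/eqP => h; move: zw0; rewrite h Normc.normc0 ltxx.
have v0 : v != 0 by rewrite invr_eq0.
have vr : normc v * rho < 1 by rewrite Normc.normcV mulrC ltr_pdivrMr// mul1r.
have r1i : 0 < r1^-1 by rewrite invr_gt0.
have mb k := normc_moment cK muK (ltW rho_gt0) Krho k.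
have := poly_germ_vanish (Q := fun j => reversal D w P`_j) b0 rho_gt0 mb gM r1i H0 vr.
rewrite HE// => /eqP; rewrite mulf_eq0 expf_eq0 (negbTE v0) andbF /= => /eqP.
by rewrite /g (negbTE v0) invrK addrC subrK toCK.
Qed.

End OffSupport.

(** * The minimization problem *)

Section GermMeasures.
Variables (R : realType) (f : germ R) (K : set (R * R)).
Hypothesis cK : compact K.
Local Notation C := R[i].
Implicit Types mu nu : plane_measure R.

Let a : R := complex.Re (f 0%N).

Let oKC : open (~` K).
Proof. by apply: closed_openC; apply: compact_closed. Qed.

Lemma msupport_null mu : msupport mu `<=` K <-> mu (~` K) = 0%E.
Proof.
split => [suppK|muK z suppz]; last first.
  by apply: contrapT => Kz; have := suppz _ oKC Kz; rewrite muK ltxx.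
apply: open_null_plane => // z Kz.
have /existsNP[U /not_implyP[oU /not_implyP[Uz /negP muU]]] : ~ msupport mu z.
  by move=> /suppK.
exists U; split => //; apply/eqP; rewrite eq_le measure_ge0 andbT.
by rewrite leNgt.
Qed.

Lemma germ_measures_null mu : germ_measures f K mu -> mu (~` K) = 0%E.
Proof. by move=> [/msupport_null]. Qed.

(** The zeroth moment. This common mass makes the estimates uniform and lets the ultrafilter
    argument apply. *)
Lemma germ_measures_mass mu : germ_measures f K mu -> mu setT = a%:E.
Proof.
move=> [_ /(_ 0%N) h]; rewrite /a -h /= -[LHS](@fineK R); last exact: fin_num_measure.
by congr EFin; rewrite -[LHS]mul1r -Rintegral_cst.
Qed.

Lemma continuous_real_complex (h : R * R -> R) : continuous h ->
  continuous ((fun z => (h z)%:C%C) : R * R -> C^o).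
Proof.
move=> ch z; apply/cvgrPdist_lt => e e0.
have eE : e = ((complex.Re e)%:C)%C.
  by move: e0; case: (e) => x y; rewrite ltcE /= => /andP[/eqP -> _].
have re0 : 0 < complex.Re e by move: e0; rewrite eE ltcR.
have /cvgrPdist_lt/(_ _ re0) := ch z; apply: filterS => y hy.
by rewrite eE -rmorphB /= -normcE ltcR normc_real.
Qed.

Lemma continuous_Re : continuous (@complex.Re R : C^o -> R).
Proof.
move=> z A /nbhs_ballP[e /= e0 eA]; apply/nbhs_ballP.
exists (e%:C%C : C^o); first by rewrite /= ltcR.
move=> y; rewrite -ball_normE /= -normcE ltcR => zy; apply: eA.
rewrite -ball_normE /=; apply: le_lt_trans zy.
by apply: le_trans (normr_Re_le _); case: (z) => ? ?; case: (y).
Qed.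

(** A real test function is viewed in complex [C(K)]; the map is then the initial map, followed by
    evaluation at that function and by the real part. *)
Lemma weak_star_cvg mu (h : R * R -> R) : continuous h ->
  (fun nu : weak_star K => Rintegral (nu : plane_measure R) K h) @ (mu : weak_star K)
    --> Rintegral mu K h.
Proof.
move=> ch.
pose phi : continuous_on K := exist _ ((fun z => (h z)%:C%C) : R * R -> C^o)
  (continuous_subspaceT (continuous_real_complex ch)).
pose E (nu : weak_star K) : C^o := Cintegral (nu : plane_measure R) K (sval phi).
have cE : E @ (mu : weak_star K) --> E mu.
  have ci : continuous ((fun nu psi => Cintegral (nu : plane_measure R) K (sval psi))
      : weak_star K -> {ptws continuous_on K -> C^o}) by exact: initial_continuous.
  move=> A hA; apply: (ci mu (fun psi => A (psi phi))).
  exact: (@proj_continuous (continuous_on K) (fun=> C^o) phi _ A hA).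
have ReE nu : complex.Re (E nu) = Rintegral (nu : plane_measure R) K h by [].
by move=> A hA; apply: (cE (fun y => A (complex.Re y))); exact: (@continuous_Re (E mu) A hA).
Qed.

Lemma weak_star_cvg_within mu (h : R * R -> R) : germ_measures f K mu -> continuous h ->
  (fun nu : plane_measure R => Rintegral nu setT h) @
    within (germ_measures f K) (nbhs (mu : weak_star K)) --> Rintegral mu setT h.
Proof.
move=> Mmu ch; have mK := compact_measurable_plane cK.
have onK nu : germ_measures f K nu -> Rintegral nu setT h = Rintegral nu K h.
  move=> Mnu; have nuK := germ_measures_null Mnu.
  by apply: Rintegral_on => //; exact: (integrable_continuous cK nuK ch).
apply/cvgrPdist_lt => e e0.
have /cvgrPdist_lt/(_ e e0) := @weak_star_cvg mu h ch.
rewrite /within /=; apply: filterS => nu hnu Mnu.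
by rewrite (onK mu)// (onK nu).
Qed.

(** Real and imaginary parts of the moments are integrals of continuous functions, constant on the
    set; limits along [U] preserve them. *)
Lemma germ_measures_closed (U : set_system (plane_measure R)) mu : ProperFilter U ->
  U (germ_measures f K) -> mu (~` K) = 0%E ->
  (forall h, continuous h ->
    (fun nu : plane_measure R => Rintegral nu setT h) @ U --> Rintegral mu setT h) ->
  germ_measures f K mu.
Proof.
move=> UU UM muK Ucvg; split; first exact/msupport_null.
have constU (h : R * R -> R) x : continuous h ->
    U [set nu : plane_measure R | Rintegral nu setT h = x] -> Rintegral mu setT h = x.
  move=> ch Ux; have cx : (fun=> x : R) @ U --> x by exact: cvg_cst.
  apply/eqP; rewrite eq_le; apply/andP; split.
  - by apply: (ultra_lim_le UU (Ucvg h ch) cx); apply: filterS Ux => nu /= ->.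
  - by apply: (ultra_lim_le UU cx (Ucvg h ch)); apply: filterS Ux => nu /= ->.
have cpow n : continuous (fun z : R * R => complex.Re (toC z ^+ n)) /\
    continuous (fun z : R * R => complex.Im (toC z ^+ n)).
  elim: n => [|n [IH1 IH2]].
    by split => z; exact: cvg_cst.
  split => z.
  - rewrite (_ : (fun z : R * R => _) = fun z : R * R =>
      z.1 * complex.Re (toC z ^+ n) - z.2 * complex.Im (toC z ^+ n)); last first.
      by apply/funext => y; rewrite exprS ReM.
    apply: cvgB; apply: cvgM; do ?[exact: IH1|exact: IH2|exact: continuous_fst_plane
      |exact: continuous_snd_plane].
  - rewrite (_ : (fun z : R * R => _) = fun z : R * R =>
      z.1 * complex.Im (toC z ^+ n) + z.2 * complex.Re (toC z ^+ n)); last first.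
      by apply/funext => y; rewrite exprS ImM.
    apply: cvgD; apply: cvgM; do ?[exact: IH1|exact: IH2|exact: continuous_fst_plane
      |exact: continuous_snd_plane].
move=> n; have [c1 c2] := cpow n.
rewrite [RHS](_ : f n = (complex.Re (f n) +i* complex.Im (f n))%C); last by case: (f n).
rewrite /Cintegral; congr (_ +i* _)%C; apply: constU => //;
  by apply: filterS UM => nu [_ /(_ n) <-].
Qed.

End GermMeasures.

Lemma ae_subset (R : realType) (A B : R * R -> Prop) : (forall z, A z -> B z) ->
  {ae dA R, forall z, A z} -> {ae dA R, forall z, B z}.
Proof.
move=> AB [N [mN N0 hN]]; exists N; split => // z /= nB.
by apply: hN => /= Az; apply: nB; exact: AB.
Qed.

Section Minimization.
Variables (R : realType) (f : germ R) (P : {poly {poly R[i]}}) (K : set (R * R)) (d : nat).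
Hypotheses (cK : compact K) (dP : degw P = d.+1).
Implicit Types mu nu : plane_measure R.

Let a : R := complex.Re (f 0%N).

Lemma germ_measures_defect_fin mu : germ_measures f K mu -> defect P K mu \is a fin_num.
Proof. by move=> Mmu; exact: (defect_fin_num cK dP (germ_measures_mass Mmu)). Qed.

Lemma defect_min_attained : germ_measures f K !=set0 ->
  exists2 mu, germ_measures f K mu & defect P K mu = min_defect P f K.
Proof.
move=> [mu0 Mmu0].
have a0 : 0 <= a by rewrite -lee_fin -(germ_measures_mass Mmu0).
set m := min_defect P f K.
have m_le mu : germ_measures f K mu -> (m <= defect P K mu)%E.
  by move=> Mmu; apply: ereal_inf_lbound; exists mu.
have m0 : (0 <= m)%E by apply: le_ereal_inf_tmp => _ [mu _ <-]; exact: defect_ge0.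
have mfin : m \is a fin_num.
  rewrite ge0_fin_numE//; apply: le_lt_trans (m_le _ Mmu0) _.
  by rewrite ltey_eq germ_measures_defect_fin.
have seq (n : nat) : exists nu, germ_measures f K nu /\
    fine (defect P K nu) <= fine m + n.+1%:R^-1.
  have n0 : 0 < (n.+1%:R^-1 : R) by rewrite invr_gt0.
  have [_ [nu Mnu <-] h] := lb_ereal_inf_adherent n0 mfin.
  exists nu; split => //; apply: fine_leD (ltW h) => //; exact: germ_measures_defect_fin.
have [nu hnu] := choice seq.
(* An ultrafilter finer than the minimizing sequence takes the place of a convergent subsequence. *)
have [U [UU FU]] := ultraFilterLemma (fmap_proper_filter nu eventually_filter).
have UM : U (germ_measures f K).
  by apply: FU; exists 0%N => // n _; have [] := hnu n.
have Umass : U [set nu : plane_measure R | nu (~` K) = 0%E /\ nu setT = a%:E].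
  apply: filterS UM => nu' Mnu'; split; first exact: (germ_measures_null cK Mnu').
  exact: germ_measures_mass Mnu'.
have [mu [muK muT Ucvg]] := measure_weak_limit cK a0 UU Umass.
have Mmu : germ_measures f K mu.
  exact: (germ_measures_closed cK (@ultra_proper _ _ UU) UM muK Ucvg).
exists mu => //; apply/eqP; rewrite eq_le m_le// andbT.
have Dcvg := defect_cvg cK dP (@filter_filter _ _ (@ultra_proper _ _ UU)) muK muT Umass Ucvg.
have Dfin := germ_measures_defect_fin Mmu.
rewrite -(fineK Dfin) -(fineK mfin) lee_fin; apply/ler_addgt0Pr => e e0.
have fcvg : (fun nu => fine (defect P K nu)) @ U --> fine (defect P K mu).
  by move: Dcvg; rewrite -{1}(fineK Dfin) => /fine_cvgP[].
have cc : (fun=> fine m + e) @ U --> fine m + e by exact: cvg_cst.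
apply: (ultra_lim_le (@ultra_proper _ _ UU) fcvg cc).
apply: FU; have [N _ hN] := near_infty_natSinv_lt (PosNum e0).
exists N => // n /= Nn; have [_ h] := hnu n; apply: le_trans h _.
by rewrite lerD2l ltW//; exact: (hN n Nn).
Qed.

(** On [K], a nonnegative function has integral 0 exactly when it vanishes almost everywhere, and
    the root vanishes only with its argument; off [K] the equation holds at every point. *)
Lemma defect_eq0P mu : convex_set (K : set (convex_lmodType (R * R)%type)) ->
  annihilates P f -> germ_measures f K mu -> defect P K mu = 0%E <-> solves_ae P mu.
Proof.
move=> convK annP Mmu; have mK := compact_measurable_plane cK.
have muK := germ_measures_null cK Mmu.
have mD : measurable_fun K (EFin \o (fun z => rooted P (toC z) (cauchy_transform mu z))
    : plane R -> \bar R).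
  by apply/measurable_EFinP; apply: measurable_funTS; exact: measurable_rooted_cauchy.
have rooted0 z : rooted P (toC z) (cauchy_transform mu z) = 0 <->
    eval2 P (toC z) (cauchy_transform mu z) = 0.
  rewrite /rooted; split => [/eqP|->]; last first.
    by rewrite Normc.normc0 powR0// invr_eq0 dP pnatr_eq0.
  by rewrite powR_eq0 => /andP[/eqP/Normc.eq0_normc].
have := ae_eq_integral_abs (dA R) mK mD.
rewrite (_ : (\int[dA R]_(z in K) _)%E = defect P K mu); last first.
  apply: eq_integral => z _ /=; congr EFin; rewrite ger0_norm//; exact: powR_ge0.
move=> ->; split; apply: ae_subset => z hz.
- have [Kz|nKz] := pselect (K z).
    by apply/rooted0; have := hz Kz => -[].
  by case: Mmu => _ fE; exact: (cauchy_off_support cK convK annP muK fE nKz).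
- by move=> _; congr EFin; apply/rooted0.
Qed.

End Minimization.

Theorem theorem1 (R : realType) (f : germ R) (P : {poly {poly R[i]}})
    (K : set (R * R)) :
  positive_algebraic f ->
  defining_polynomial f P ->
  compact K ->
  convex_set (K : set (convex_lmodType (R * R)%type)) ->
  germ_measures f K !=set0 ->
  [/\ forall mu, germ_measures f K mu -> defect P K mu \is a fin_num,
      {within (germ_measures f K : set (weak_star K)),
         continuous (defect P K : weak_star K -> \bar R)},
      exists2 mu, germ_measures f K mu & defect P K mu = min_defect P f K,
      min_defect P f K = 0%E <->
        exists2 mu, germ_measures f K mu & solves_ae P mu &
      min_defect P f K = 0%E ->
        forall mu, germ_measures f K mu -> defect P K mu = min_defect P f K ->
          solves_ae P mu].
Proof.
move=> _ [_ degP annP] cK convK M0.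
have dP : degw P = (degw P).-1.+1 by rewrite prednK.
have min_attained := defect_min_attained cK dP M0.
have zeroP mu := @defect_eq0P R f P K _ cK dP mu convK annP.
split => //.
- exact: (germ_measures_defect_fin cK dP).
(* Continuity on the subset is convergence along the trace of the neighbourhood filter, on which all
   measures have the same mass and are carried by [K]. *)
- apply/subspace_continuousP => mu Mmu.
  apply: (defect_cvg cK dP (a := complex.Re (f 0%N))).
  + exact: (germ_measures_null cK Mmu).
  + exact: germ_measures_mass Mmu.
  + apply: filterS (withinT _ _) => nu Mnu; split.
      exact: (germ_measures_null cK Mnu).
    exact: germ_measures_mass Mnu.
  + by move=> h ch; exact: (weak_star_cvg_within cK).
- split => [min0|[mu Mmu solmu]].
    have [mu Mmu muE] := min_attained; exists mu => //.
    by apply/(zeroP mu Mmu); rewrite muE.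
  apply/eqP; rewrite eq_le; apply/andP; split.
    by apply: ereal_inf_lbound; exists mu => //; apply/(zeroP mu Mmu).
  by apply: le_ereal_inf_tmp => _ [nu _ <-]; exact: defect_ge0.
- by move=> min0 mu Mmu muE; apply/(zeroP mu Mmu); rewrite muE.
Qed.
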